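(* Let $\mu,\nu\in\{0,1,2,\dots,\infty\}$. For every perfect Lagrangian linear relation $T:\mathbb V_{2\mu}\rightrightarrows\mathbb V_{2\nu}$, the operator $W(T):\ell^2(V_\mu^d)\to\ell^2(V_\nu^d)$ is, up to a scalar factor, a Gaussian operator. Conversely, every Gaussian operator $\ell^2(V_\mu^d)\to\ell^2(V_\nu^d)$ has the form $W(T)$ (up to a scalar factor) for some perfect Lagrangian linear relation $T:\mathbb V_{2\mu}\rightrightarrows\mathbb V_{2\nu}$.
   Context: $\mathbb F$ is a finite field of characteristic $p>2$, and $\mathsf{Exp}:\mathbb F\to\mathbb C^\times$ is a fixed nontrivial character of the additive group of $\mathbb F$. For $n=0,1,2,\dots$, $V_n^d$ and $V_n^c$ are two copies of $\mathbb F^n$ (discrete topology). $V_\infty^d$ is the direct sum of countably many copies of $\mathbb F$ with the discrete topology; $V_\infty^c$ is the direct product of countably many copies of $\mathbb F$ with the product topology. For $\mu\in\{0,1,\dots,\infty\}$, $\mathbb V_{2\mu}:=V_\mu^d\oplus V_\mu^c$ (product of the topologies), with the symplectic form $\{(x,y),(x',y')\}=\sum_{j=1}^\mu(x_jy_j'-y_jx_j')$. For $v=(v^d,v^c)\in\mathbb V_{2\mu}$, $a(v)$ is the unitary operator in $\ell^2(V_\mu^d)$ given by $a(v)f(x)=f(x+v^d)\,\mathsf{Exp}\bigl[\sum_j(x_jv_j^c+\tfrac12v_j^dv_j^c)\bigr]$. A linear relation $T:X\rightrightarrows Y$ between $\mathbb F$-linear spaces is a linear subspace of $X\oplus Y$.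 For such $T$: $\ker T=T\cap(X\oplus 0)$; $\operatorname{dom}T$ is the projection of $T$ to $X$; $\operatorname{im}T$ is the projection of $T$ to $Y$; $\operatorname{indef}T=T\cap(0\oplus Y)$. $\ker T,\operatorname{dom}T$ are regarded as subspaces of $X$, and $\operatorname{im}T,\operatorname{indef}T$ as subspaces of $Y$. A subspace $Z\subset\mathbb V_{2\mu}$ is codiscrete if it is closed and the quotient $\mathbb V_{2\mu}/Z$ is discrete. Equip $\mathbb V_{2\mu}\oplus\mathbb V_{2\nu}$ with the form $\{(v,w),(v',w')\}=\{v,v'\}_{\mathbb V_{2\mu}}-\{w,w'\}_{\mathbb V_{2\nu}}$. A linear relation $T:\mathbb V_{2\mu}\rightrightarrows\mathbb V_{2\nu}$ is perfect Lagrangian if: (1) $T$ is a maximal isotropic subspace of $\mathbb V_{2\mu}\oplus\mathbb V_{2\nu}$ (in particular $T$ is closed); (2) $\ker T$ and $\operatorname{indef}T$ are compact; (3) $\operatorname{im}T$ and $\operatorname{dom}T$ are codiscrete. For a perfect Lagrangian $T:\mathbb V_{2\mu}\rightrightarrows\mathbb V_{2\nu}$, $W(T):\ell^2(V_\mu^d)\to\ell^2(V_\nu^d)$ denotes the non-zero bounded operator, existing and unique up to a scalar factor, such that $a(w)W(T)=W(T)a(v)$ for all $(v,w)\in T$. Gaussian operators: let $H\subset V_\mu^d\oplus V_\nu^d$ be a subspace such that the projections $H\to V_\mu^d\oplus0$ and $H\to0\oplus V_\nu^d$ have finite-dimensional kernels, and let $Q$ be an $\mathbb F$-valued quadratic form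 on $H$. The Gaussian operator $G(H;Q):\ell^2(V_\mu^d)\to\ell^2(V_\nu^d)$ is $$G(H;Q)f(x)=\sum_{y:\,(y,x)\in H}\mathsf{Exp}\bigl(Q(x,y)\bigr)f(y),$$ where $x\in V_\nu^d$, $y\in V_\mu^d$, and $Q(x,y)$ denotes the value of $Q$ at the point $(y,x)\in H$. *)

(* Defs.v *)
From HB Require Import structures.
From mathcomp Require Import all_boot all_order all_algebra generic_quotient.
From mathcomp Require Import finfield ring lra.
From mathcomp Require Import complex.
From mathcomp Require Import mathcomp_extra boolp classical_sets functions.
From mathcomp Require Import cardinality fsbigop reals ereal topology esum.

Set Implicit Arguments.
Unset Strict Implicit.
Unset Printing Implicit Defensive.

Import Order.TTheory GRing.Theory Num.Theory.

Local Open Scope classical_set_scope.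
Local Open Scope ring_scope.

(** * The spaces V_mu^d, V_mu^c and V_(2 mu) *)

(** A dimension [mu] in {0, 1, 2, ..., oo} is an [option nat], [None] being
    infinity; [Idx mu] is the set of coordinates. *)
Definition Idx (mu : option nat) : countType :=
  if mu is Some n then 'I_n else nat.

Definition finsupp (F : finFieldType) (mu : option nat) :
    {pred Idx mu -> F^o} :=
  fun x => `[< finite_set [set j | x j != 0] >].

Section discrete_part.
Variables (F : finFieldType) (mu : option nat).

Lemma finsupp_submod_closed : GRing.submod_closed (@finsupp F mu).
Proof.
split=> [|a x y /asboolP fx /asboolP fy]; apply/asboolP.
  apply: (sub_finite_set _ (@finite_set0 (Idx mu))) => j /=.
  by rewrite eqxx.
have : finite_set ([set j | x j != 0] `|` [set j | y j != 0]).
  by rewrite finite_setU.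
apply: sub_finite_set => j /= h.
have [xj0|xj0] := eqVneq (x j) 0; last by left.
right; apply: contraNneq h => yj0.
by change (a *: x j + y j == 0); rewrite xj0 yj0 scaler0 addr0.
Qed.

HB.instance Definition _ :=
  GRing.isSubmodClosed.Build F (Idx mu -> F^o) (@finsupp F mu)
    finsupp_submod_closed.

Record Vd := MkVd { vd_fun :> Idx mu -> F^o; _ : vd_fun \in @finsupp F mu }.

HB.instance Definition _ := [isSub for vd_fun].
HB.instance Definition _ := [Choice of Vd by <:].
HB.instance Definition _ := [SubChoice_isSubLmodule of Vd by <:].
HB.instance Definition _ := Topological.copy Vd (discrete_topology Vd).

End discrete_part.

Definition Vc (F : finFieldType) (mu : option nat) : Type := Idx mu -> F^o.

HB.instance Definition _ (F : finFieldType) (mu : option nat) :=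
  GRing.Lmodule.copy (Vc F mu) (Idx mu -> F^o).
HB.instance Definition _ (F : finFieldType) (mu : option nat) :=
  Topological.copy (Vc F mu) {ptws Idx mu -> discrete_topology F}.

Notation V2 F mu := (Vd F mu * Vc F mu)%type.

(** All but finitely many terms of this sum vanish. *)
Definition symp (F : finFieldType) (mu : option nat) (u v : V2 F mu) : F :=
  \sum_(j \in [set: Idx mu]) (u.1 j * v.2 j - u.2 j * v.1 j).

(** * Linear relations *)

Section linear_relations.
Variables (F : fieldType).

Definition subspace_set (V : lmodType F) (S : set V) : Prop :=
  S 0 /\ forall (a : F) u v, S u -> S v -> S (a *: u + v).

Variables (X Y : lmodType F) (T : set (X * Y)).

Definition rel_ker : set X := [set v | T (v, 0)].
Definition rel_dom : set X := [set v | exists w, T (v, w)].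
Definition rel_im : set Y := [set w | exists v, T (v, w)].
Definition rel_indef : set Y := [set w | T (0, w)].

End linear_relations.

(** The quotient V / Z is the set of the cosets [u + Z]. *)
Section quotient.
Variables (V : zmodType) (Z : set V).

Definition acoset (u : V) : set V := [set u + z | z in Z].

Definition coset_eq : rel V := fun u v => `[< acoset u = acoset v >].

Lemma coset_eq_refl : reflexive coset_eq.
Proof. by move=> u; apply/asboolP. Qed.

Lemma coset_eq_sym : symmetric coset_eq.
Proof. by move=> u v; apply/asboolP/asboolP => ->. Qed.

Lemma coset_eq_trans : transitive coset_eq.
Proof. by move=> v u w /asboolP uv /asboolP vw; apply/asboolP; rewrite uv. Qed.

Definition coset_equiv := EquivRel coset_eq coset_eq_refl coset_eq_sym
  coset_eq_trans.

Definition quotient_by : quotType V := {eq_quot coset_equiv}%qT.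

End quotient.

Definition codiscrete (F : finFieldType) (mu : option nat)
    (Z : set (V2 F mu)) : Prop :=
  [/\ subspace_set Z, closed Z &
      forall U : set (quotient_topology (quotient_by Z)), open U].

Section perfect_lagrangian.
Variables (F : finFieldType) (mu nu : option nat).
Implicit Types S T : set (V2 F mu * V2 F nu).

Definition rel_form (p q : V2 F mu * V2 F nu) : F :=
  symp p.1 q.1 - symp p.2 q.2.

Definition isotropic S : Prop :=
  subspace_set S /\ forall p q, S p -> S q -> rel_form p q = 0.

Definition maximal_isotropic T : Prop :=
  isotropic T /\ forall S, isotropic S -> T `<=` S -> S = T.

Definition perfect_lagrangian T : Prop :=
  [/\ maximal_isotropic T,
      compact (rel_ker T) /\ compact (rel_indef T) &
      codiscrete (rel_im T) /\ codiscrete (rel_dom T)].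

End perfect_lagrangian.

(** * The Hilbert spaces l^2(X) and their operators *)

Local Notation normc := Normc.normc.

Section sqsum.
Variables (R : realType) (X : choiceType).

Definition sqsum (f : X -> R[i]^o) : \bar R :=
  \esum_(x in [set: X]) ((normc (f x)) ^+ 2)%:E.

Definition sqsummable : {pred X -> R[i]^o} := fun f => (sqsum f < +oo)%E.

Lemma normc_ge0 (z : R[i]) : 0 <= normc z.
Proof. by case: z => a b; exact: sqrtr_ge0. Qed.

Lemma sqsumZ (a : R[i]) (f : X -> R[i]^o) :
  f \in sqsummable -> a *: f \in sqsummable.
Proof.
rewrite /sqsummable !unfold_in => hf.
apply: (@le_lt_trans _ _ ((normc a ^+ 2)%:E * sqsum f)%E); last first.
  by rewrite lte_mul_pinfty ?lee_fin ?exprn_ge0 ?normc_ge0.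
apply: ge_ereal_sup => _ [A [finA _] <-].
under eq_fsbigr => x _ do rewrite [normc _]Normc.normcM exprMn EFinM.
rewrite -ge0_mule_fsumr; last by move=> x; rewrite lee_fin sqr_ge0.
apply: lee_wpmul2l; first by rewrite lee_fin sqr_ge0.
by apply: esum_ge; exists A.
Qed.

Lemma sqsumD (f g : X -> R[i]^o) :
  f \in sqsummable -> g \in sqsummable -> f + g \in sqsummable.
Proof.
rewrite /sqsummable !unfold_in => hf hg.
have h0 (h : X -> R[i]^o) x : (0 <= ((normc (h x)) ^+ 2)%:E)%E.
  by rewrite lee_fin sqr_ge0.
apply: (@le_lt_trans _ _ ((sqsum f + sqsum g) + (sqsum f + sqsum g))%E);
  last by rewrite !lte_add_pinfty.
rewrite /sqsum -esumD// -esumD; do ?by move=> x _; rewrite adde_ge0.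
apply: le_esum => x _; rewrite -!EFinD lee_fin.
have := le_normcD (f x) (g x); have := normc_ge0 (f x + g x).
have := normc_ge0 (f x); have := normc_ge0 (g x).
change ((f + g) x) with (f x + g x).
move: (normc (f x + g x)) (normc (f x)) (normc (g x)) => c a b b0 a0 c0 cab.
rewrite (le_trans (y := (a + b) ^+ 2))//; first by rewrite lerXn2r ?nnegrE ?addr_ge0.
have := sqr_ge0 (a - b); nra.
Qed.

Lemma sqsummable_submod_closed : GRing.submod_closed sqsummable.
Proof.
split=> [|a f g hf hg]; last by rewrite sqsumD ?sqsumZ.
rewrite /sqsummable unfold_in /sqsum esum1 ?ltry// => x _.
by rewrite Normc.normc0 expr0n.
Qed.

HB.instance Definition _ :=
  GRing.isSubmodClosed.Build R[i] (X -> R[i]^o) sqsummable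
    sqsummable_submod_closed.

Record ell2 := MkEll2 { ell2_fun :> X -> R[i]^o; _ : ell2_fun \in sqsummable }.

HB.instance Definition _ := [isSub for ell2_fun].
HB.instance Definition _ := [Choice of ell2 by <:].
HB.instance Definition _ := [SubChoice_isSubLmodule of ell2 by <:].

Definition ell2_norm (f : ell2) : R := Num.sqrt (fine (sqsum f)).

End sqsum.

Definition bounded_op (R : realType) (X Y : choiceType)
    (A : ell2 R X -> ell2 R Y) : Prop :=
  exists M : R, forall f, ell2_norm (A f) <= M * ell2_norm f.

(** * Additive characters and the operators a(v) *)

Record add_char (F : finFieldType) (R : realType) := AddChar {
  add_char_fun :> F -> R[i];
  add_charD : forall s t, add_char_fun (s + t) = add_char_fun s * add_char_fun t;
  add_char_neq0 : forall t, add_char_fun t != 0 }.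

Definition nontrivial_char (F : finFieldType) (R : realType)
  (chi : add_char F R) : Prop := exists t, chi t != 1.

Section weyl.
Variables (F : finFieldType) (R : realType) (chi : add_char F R).
Variable mu : option nat.

Lemma normc_add_char t : normc (chi t) = 1.
Proof.
have [p p_pr pF] := finPcharP F.
have chi0 : chi 0 = 1.
  by apply: (mulfI (add_char_neq0 chi 0)); rewrite -add_charD addr0 mulr1.
have chiX n : chi (t *+ n) = chi t ^+ n.
  by elim: n => [|n IH]; rewrite ?mulr0n ?chi0// mulrS add_charD IH exprS.
have normcX z n : normc (z ^+ n) = normc z ^+ n :> R.
  by elim: n => [|n IH]; rewrite ?Normc.normc1// !exprS Normc.normcM IH.
apply/eqP; rewrite -(pexpr_eq1 (n := p)) ?normc_ge0 ?prime_gt0//.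
by rewrite -normcX -chiX (mulrn_pchar pF) chi0 Normc.normc1.
Qed.

Definition weyl_fun (v : V2 F mu) (f : Vd F mu -> R[i]^o) : Vd F mu -> R[i]^o :=
  fun x => f (x + v.1) *
    chi (\sum_(j \in [set: Idx mu]) (x j * v.2 j + 2%:R^-1 * v.1 j * v.2 j)).

Lemma weyl_fun_sqsummable v (f : ell2 R (Vd F mu)) :
  weyl_fun v f \in @sqsummable R (Vd F mu).
Proof.
case: f => f hf /=; rewrite /sqsummable unfold_in /sqsum.
have bij : set_bij [set: Vd F mu] [set: Vd F mu] (fun x => x + v.1).
  split=> // [x y _ _ /addIr //|y _].
  by exists (y - v.1) => //; rewrite subrK.
move: hf; rewrite /sqsummable unfold_in /sqsum (reindex_esum _ _ _ _ bij).
congr (_ < _)%E; apply: eq_esum => x _.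
by rewrite /weyl_fun Normc.normcM normc_add_char mulr1.
Qed.

Definition weyl (v : V2 F mu) (f : ell2 R (Vd F mu)) : ell2 R (Vd F mu) :=
  MkEll2 (weyl_fun_sqsummable v f).

End weyl.

(** [W(T)] is only defined up to a scalar factor: [is_W chi T A] says that [A]
    is one of its representatives. *)
Definition is_W (F : finFieldType) (R : realType) (chi : add_char F R)
    (mu nu : option nat) (T : set (V2 F mu * V2 F nu))
    (A : {linear ell2 R (Vd F mu) -> ell2 R (Vd F nu)}) : Prop :=
  [/\ bounded_op A, (exists f, A f != 0) &
      forall v w, T (v, w) -> forall f, weyl chi w (A f) = A (weyl chi v f)].

(** * Gaussian operators *)

Definition finite_dim (F : fieldType) (V : lmodType F) (K : set V) : Prop :=
  exists (n : nat) (e : 'I_n -> V),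
    K = [set \sum_(k < n) c k *: e k | c in [set: 'I_n -> F]].

(** [Q] is a quadratic form on the subspace [H]; its values off [H] are
    irrelevant. *)
Definition quadratic_form_on (F : fieldType) (V : lmodType F) (H : set V)
    (Q : V -> F) : Prop :=
  let B u v := Q (u + v) - Q u - Q v in
  (forall a u, H u -> Q (a *: u) = a ^+ 2 * Q u) /\
  (forall a u v w, H u -> H v -> H w ->
     B (a *: u + v) w = a * B u w + B v w).

Section gaussian.
Variables (F : finFieldType) (R : realType) (chi : add_char F R).
Variables (mu nu : option nat).

(** The kernel of the first projection consists of the pairs [(0, x)] of [H],
    that of the second one of the pairs [(y, 0)]. *)
Definition gaussian_data (H : set (Vd F mu * Vd F nu))
    (Q : Vd F mu * Vd F nu -> F) : Prop :=
  [/\ subspace_set H,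
      finite_dim (H `&` [set h | h.1 = 0]),
      finite_dim (H `&` [set h | h.2 = 0]) &
      quadratic_form_on H Q].

(** For [gaussian_data H Q] the sum is finite. *)
Definition gaussian (H : set (Vd F mu * Vd F nu)) (Q : Vd F mu * Vd F nu -> F)
    (f : Vd F mu -> R[i]^o) : Vd F nu -> R[i]^o :=
  fun x => \sum_(y \in [set y | H (y, x)]) (chi (Q (y, x)) * f y).

End gaussian.

(* Main.v *)
Require Import Defs.
From HB Require Import structures.
From mathcomp Require Import all_boot all_order all_algebra generic_quotient.
From mathcomp Require Import ring lra.
From mathcomp Require Import complex.
From mathcomp Require Import mathcomp_extra boolp classical_sets functions.
From mathcomp Require Import cardinality fsbigop reals ereal topology esum.

(** For Gaussian data (H, Q), let B be the polar form of Q and let T(H, Q),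
    written [lagr H Q], be the set of the pairs (v, w) such that k = (v^d, w^d)
    lies in H and B(h, k) = y.v^c - x.w^c for all h = (y, x) in H. At h = k this
    gives 2 Q(k) = v^d.v^c - w^d.w^c, and then a shift of the summation variable
    by v^d shows that a(w) G(H; Q) = G(H; Q) a(v). The theorem follows from
    three facts about T(H, Q).

    The relations T(H, Q) are exactly the perfect Lagrangian ones. That T(H, Q)
    is maximal isotropic is [lagr_maximal], by duality between the direct sum
    V^d and its full algebraic dual V^c. Its kernel is closed with finitely many
    discrete parts, hence compact, and its image contains all (0, c) with c
    vanishing on some finite set of coordinates, hence is codiscrete; the other
    two conditions follow by transposition. Conversely, given T, take for H the
    set of the discrete parts k of its elements, and Q(k) = (k.c) / 2 for a
    continuous part c over k ([maximal_isotropic_lagr]). The kernels of the two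
    projections of H are finite since otherwise the open image of T, or its
    domain, would provide uncountably many functionals where isotropy allows
    only countably many ([finite_indef_base], by a diagonal argument).

    The operator G(H; Q) has a matrix with entries of modulus 1 or 0 and
    boundedly many nonzero ones in each row and column, so it is bounded
    ([gaussian_bounded]); it maps the unit vector at 0 to a function whose value
    at 0 is 1, so it is not zero.

    Every bounded operator with the intertwining property is a multiple of
    G(H; Q) ([is_W_gaussian]): the relations attached to the elements of T with
    discrete part 0 force its matrix to vanish outside of H, the other ones
    determine it on H up to the entry at 0, and bounded operators are determined
    by their matrices. *)

Import Order.TTheory GRing.Theory Num.Theory.

Local Open Scope classical_set_scope.
Local Open Scope ring_scope.

Set Implicit Arguments.
Unset Strict Implicit.
Unset Printing Implicit Defensive.

Local Notation normc := Normc.normc.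

(** * The pairing of V^d and V^c, and linear extension *)

Section pairing.
Variables (F : finFieldType) (mu : option nat).
Implicit Types (x y : Vd F mu) (c d : Vc F mu) (j : Idx mu).

Definition dot x c : F := \sum_(j \in [set: Idx mu]) (x j : F) * c j.

Lemma vdE a x y j : (a *: x + y) j = a * (x j : F) + y j :> F.
Proof. by []. Qed.

Lemma vcE a c d j : (a *: c + d) j = a * (c j : F) + d j :> F.
Proof. by []. Qed.

Lemma vd_eq x y : (forall j, x j = y j) -> x = y.
Proof. by move=> xy; apply: val_inj; apply/funext => j; exact: xy. Qed.

Lemma vd_supp x : exists2 s : seq (Idx mu), uniq s &
  forall j, j \notin s -> x j = 0.
Proof.
have /asboolP/finite_seqP[s hs] := valP x.
exists (undup s) => [|j]; first exact: undup_uniq.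
rewrite mem_undup => js; apply/eqP/negPn/negP => xj; apply: (negP js).
by have : [set` s] j by rewrite -hs.
Qed.

(** The sums over all coordinates are given by a default value when their
    support is infinite; every computation goes through a finite list of
    coordinates outside of which the summand vanishes. *)
Lemma fsum_suppE (s : seq (Idx mu)) (f : Idx mu -> F) : uniq s ->
  (forall j, j \notin s -> f j = 0) ->
  \sum_(j \in [set: Idx mu]) f j = \sum_(j <- s) f j.
Proof.
move=> us hs; rewrite (fsbigE s)//; last by move=> j _; exact: hs.
by apply: eq_bigl => j; rewrite in_setT.
Qed.

Lemma dotE (s : seq (Idx mu)) x c : uniq s ->
  (forall j, j \notin s -> x j = 0) -> dot x c = \sum_(j <- s) (x j : F) * c j.
Proof.
by move=> us hs; apply: fsum_suppE => // j /hs xj; rewrite xj mul0r.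
Qed.

Lemma vd_supp2 x y : exists s : seq (Idx mu), [/\ uniq s,
  forall j, j \notin s -> x j = 0 & forall j, j \notin s -> y j = 0].
Proof.
have [s us hs] := vd_supp x; have [t ut ht] := vd_supp y.
exists (undup (s ++ t)); split; first exact: undup_uniq.
  by move=> j; rewrite mem_undup mem_cat negb_or => /andP[/hs].
by move=> j; rewrite mem_undup mem_cat negb_or => /andP[_ /ht].
Qed.

Lemma dot_linl a x y c : dot (a *: x + y) c = a * dot x c + dot y c.
Proof.
have [s [us hx hy]] := vd_supp2 x y.
rewrite !(dotE (s := s))//; last first.
  by move=> j js; rewrite vdE hx// hy// mulr0 addr0.
rewrite mulr_sumr -big_split; apply: eq_bigr => j _.
by rewrite vdE mulrDl mulrA.
Qed.

Lemma dot_linr a x c d : dot x (a *: c + d) = a * dot x c + dot x d.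
Proof.
have [s us hx] := vd_supp x.
rewrite !(dotE (s := s))// mulr_sumr -big_split; apply: eq_bigr => j _.
by rewrite vcE mulrDr mulrCA.
Qed.

Lemma dotDl x y c : dot (x + y) c = dot x c + dot y c.
Proof. by rewrite -[x]scale1r dot_linl mul1r scale1r. Qed.

Lemma dot0l c : dot 0 c = 0.
Proof. by apply: (addrI (dot 0 c)); rewrite -dotDl !addr0. Qed.

Lemma dotZl a x c : dot (a *: x) c = a * dot x c.
Proof. by rewrite -[a *: x]addr0 dot_linl dot0l addr0. Qed.

Lemma dotDr x c d : dot x (c + d) = dot x c + dot x d.
Proof. by rewrite -[c]scale1r dot_linr mul1r scale1r. Qed.

Lemma dot0r x : dot x 0 = 0.
Proof. by apply: (addrI (dot x 0)); rewrite -dotDr !addr0. Qed.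

Lemma dotZr a x c : dot x (a *: c) = a * dot x c.
Proof. by rewrite -[a *: c]addr0 dot_linr dot0r addr0. Qed.

Lemma dotNl x c : dot (- x) c = - dot x c.
Proof. by rewrite -scaleN1r dotZl mulN1r. Qed.

Lemma dotNr x c : dot x (- c) = - dot x c.
Proof. by rewrite -scaleN1r dotZr mulN1r. Qed.

Lemma sympE (u v : V2 F mu) : symp u v = dot u.1 v.2 - dot v.1 u.2.
Proof.
have [s [us hu hv]] := vd_supp2 u.1 v.1.
rewrite !(dotE (s := s))// -sumrB /symp (fsum_suppE us).
  by apply: eq_bigr => j _; rewrite [u.2 j * _]mulrC.
by move=> j js; rewrite hu// hv// mul0r mulr0 subr0.
Qed.

Lemma kron_finsupp (i : Idx mu) :
  ((fun j => (j == i)%:R) : Idx mu -> F^o) \in @finsupp F mu.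
Proof.
apply/asboolP; apply: (sub_finite_set _ (finite_set1 i)) => j /=.
by have [//|_] := eqVneq j i; rewrite eqxx.
Qed.

Definition kron_d (i : Idx mu) : Vd F mu := MkVd (kron_finsupp i).

Definition kron_c (i : Idx mu) : Vc F mu := fun j => (j == i)%:R.

Lemma vd_sumE (I : Type) (s : seq I) (f : I -> Vd F mu) j :
  (\sum_(i <- s) f i) j = \sum_(i <- s) f i j.
Proof. by elim/big_rec2: _ => //= i a b _ <-. Qed.

Lemma sum_kron (s : seq (Idx mu)) (f : Idx mu -> F) j : uniq s ->
  \sum_(i <- s) f i * (j == i)%:R = if j \in s then f j else 0.
Proof.
move=> us; case: ifPn => js.
  rewrite (bigD1_seq j)//= eqxx mulr1 big1 ?addr0// => i /negPf ij.
  by rewrite eq_sym ij mulr0.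
rewrite big_seq big1// => i is_; have [ji|_] := eqVneq j i.
  by rewrite ji is_ in js.
by rewrite mulr0.
Qed.

Lemma vd_expand (s : seq (Idx mu)) x : uniq s ->
  (forall j, j \notin s -> x j = 0) -> x = \sum_(j <- s) (x j : F) *: kron_d j.
Proof.
move=> us hs; apply: vd_eq => j; rewrite vd_sumE.
transitivity (\sum_(i <- s) (x i : F) * (j == i)%:R); last by [].
by rewrite (sum_kron (fun i => x i))//; case: ifPn => // /hs.
Qed.

Lemma dot_kron_c x i : dot x (kron_c i) = x i.
Proof.
have [s us hs] := vd_supp x; rewrite (dotE (s := s))//.
transitivity (\sum_(j <- s) (x j : F) * (i == j)%:R).
  by apply: eq_bigr => j _; rewrite /kron_c eq_sym.
by rewrite (sum_kron (fun i => x i))//; case: ifPn => // /hs.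
Qed.

(** V^c is the full algebraic dual of V^d, because a linear functional on V^d
    is determined by arbitrary values on the coordinate vectors. *)
Lemma dot_functional (psi : Vd F mu -> F) :
  (forall a x y, psi (a *: x + y) = a * psi x + psi y) ->
  exists c : Vc F mu, forall x, psi x = dot x c.
Proof.
move=> lin; exists (fun j => psi (kron_d j)) => x.
have [s us hs] := vd_supp x; rewrite (dotE (s := s))//.
rewrite {1}(vd_expand us hs).
have psi0 : psi 0 = 0.
  by apply: (addrI (psi 0)); rewrite -{1}[psi 0]mul1r -lin scaler0 !addr0.
elim: (s) => [|j t IH]; first by rewrite !big_nil.
by rewrite !big_cons lin IH.
Qed.

(** A vector is a finite sum of multiples of coordinate vectors, hence is coded
    by a finite list over a countable set; the repetitions are harmless. *)
Lemma vd_countable : exists e : nat -> Vd F mu, forall x, exists n, e n = x.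
Proof.
pose g (l : seq (Idx mu * F)) : Vd F mu := \sum_(p <- l) p.2 *: kron_d p.1.
exists (fun n => if unpickle n is Some l then g l else 0) => x.
have [s us hs] := vd_supp x.
exists (pickle [seq (j, x j : F) | j <- s]).
by rewrite pickleK /g big_map -(vd_expand us hs).
Qed.

End pairing.

Section linear_extension.
Variables (F : fieldType) (X : lmodType F).

(** By Zorn's lemma there is a maximal linear graph that contains the graph of
    [phi]; if [u] were missing from its domain, one could still send [u] to 0.
    The empty set is admitted among the graphs so that the union of an empty
    chain is one of them. *)
Lemma linear_extension (H : set X) (phi : X -> F) : subspace_set H ->
  (forall a u v, H u -> H v -> phi (a *: u + v) = a * phi u + phi v) ->
  exists2 psi : X -> F,
    forall a u v, psi (a *: u + v) = a * psi u + psi v &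
    forall u, H u -> psi u = phi u.
Proof.
move=> [H0 Hlin] lin.
pose lin2 (G : set (X * F)) :=
  forall a p q, G p -> G q -> G (a *: p.1 + q.1, a * p.2 + q.2).
(* A linear graph is single-valued as soon as it is so over 0. *)
pose P (G : set (X * F)) := G = set0 \/
  [/\ lin2 G, (forall u, H u -> G (u, phi u)) & forall t, G (0, t) -> t = 0].
have [|G [PG Gmax]] := @Zorn_bigcup (X * F)%type P.
  move=> C CP tot.
  have [Call0|] := pselect (forall A, C A -> A = set0).
    by left; apply/seteqP; split => // p [A /Call0 ->].
  move/existsNP => [A0 /not_implyP[CA0 A00]]; right.
  have [|[_ HA0 _]] := CP _ CA0; first by move/A00.
  split.
  - move=> a p q [A CA Ap] [B CB Bq].
    have [AB|BA] := tot _ _ CA CB.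
    + exists B => //; have [B0|[linB _ _]] := CP _ CB.
        by rewrite B0 in Bq.
      by apply: linB => //; exact: AB.
    + exists A => //; have [A0'|[linA _ _]] := CP _ CA.
        by rewrite A0' in Ap.
      by apply: linA => //; exact: BA.
  - by move=> u Hu; exists A0 => //; exact: HA0.
  - move=> t [A CA At]; have [A0'|[_ _]] := CP _ CA; last exact.
    by rewrite A0' in At.
have phi0 : phi 0 = 0.
  apply: (addrI (phi 0)); rewrite -{1}[phi 0]mul1r -lin// scaler0.
  by rewrite !addr0.
have [G0|[linG HG fG]] := PG.
  exfalso; apply: (Gmax [set p | H p.1 /\ p.2 = phi p.1]).
    rewrite G0; split => // /(_ (0, phi 0)) /=; apply; split=> //.
  right; split => [a p q [Hp pE] [Hq qE] /=|u //=|t [_ /= ->]//].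
  by split; [exact: Hlin|rewrite pE qE lin].
have G00 : G (0, 0) by rewrite -phi0; exact: HG.
have GZ a p : G p -> G (a *: p.1, a * p.2).
  by move=> Gp; have := linG a _ _ Gp G00; rewrite /= !addr0.
have tot u : exists t, G (u, t).
  apply/not_existsP => Gu.
  apply: (Gmax [set p | exists a q, G q /\ p = (a *: u + q.1, q.2)]).
    split.
      by move=> q Gq; exists 0, q; rewrite scale0r add0r; case: q Gq.
    move=> sub; apply: (Gu 0); apply: sub; exists 1, (0, 0).
    by rewrite scale1r addr0.
  right; split.
  - move=> b p q [a [p' [Gp' ->]]] [a' [q' [Gq' ->]]] /=.
    exists (b * a + a'), (b *: p'.1 + q'.1, b * p'.2 + q'.2).
    split; first exact: linG.
    by rewrite /= scalerDr scalerA scalerDl addrACA.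
  - move=> v Hv; exists 0, (v, phi v); rewrite scale0r add0r.
    by split=> //; exact: HG.
  - move=> t [a [q [Gq [/eqP e ->]]]].
    have [a0|an0] := eqVneq a 0.
      apply: fG; move: Gq e.
      by rewrite a0 scale0r add0r eq_sym => + /eqP <-; case: q.
    exfalso; apply: (Gu (- a^-1 * q.2)).
    have -> : u = - a^-1 *: q.1.
      apply: (scalerI an0); rewrite scalerA mulrN divff// scaleN1r.
      by apply/eqP; rewrite -addr_eq0 eq_sym.
    exact: GZ.
have uniqG u s t : G (u, s) -> G (u, t) -> s = t.
  move=> Gs Gt; apply/eqP; rewrite -subr_eq0 addrC; apply/eqP/fG.
  by have := linG (-1) _ _ Gt Gs; rewrite /= scaleN1r addNr mulN1r.
have [psi hpsi] := choice tot.
exists psi => [a u v|u Hu]; last by apply: (uniqG u) => //; exact: HG.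
exact: (uniqG _ _ _ (hpsi _) (linG a _ _ (hpsi u) (hpsi v))).
Qed.

(** On the span of [H] and [u], the coefficient of [u] modulo [H] is such a
    functional; it then extends to the whole space. *)
Lemma separating_functional (H : set X) u : subspace_set H -> ~ H u ->
  exists psi : X -> F,
    [/\ forall a v w, psi (a *: v + w) = a * psi v + psi w,
        forall v, H v -> psi v = 0 & psi u = 1].
Proof.
move=> [H0 Hlin] Hu.
pose K : set X := [set v | exists a w, H w /\ v = a *: u + w].
have coefP v : exists a, K v -> H (v - a *: u).
  have [[a [w [Hw ->]]]|nK] := pselect (K v); last by exists 0 => /nK.
  by exists a => _; rewrite addrAC subrr add0r.
have [co hco] := choice coefP.
have HB v w : H v -> H w -> H (v - w).
  by move=> Hv Hw; have := Hlin (-1) _ _ Hw Hv; rewrite scaleN1r addrC.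
have HZ a v : H v -> H (a *: v).
  by move=> Hv; have := Hlin a _ _ Hv H0; rewrite addr0.
have co_uniq v a : K v -> H (v - a *: u) -> co v = a.
  move=> Kv Hv; apply/eqP; rewrite -subr_eq0; apply/negP => /negP d0.
  have := HB _ _ Hv (hco _ Kv); rewrite opprB addrC addrA subrK -scalerBl.
  by move=> /(HZ (co v - a)^-1); rewrite scalerA mulVf// scale1r.
have Klin a v w : K v -> K w -> K (a *: v + w).
  move=> [b [v' [Hv' ->]]] [b' [w' [Hw' ->]]].
  exists (a * b + b'), (a *: v' + w'); split; first exact: Hlin.
  by rewrite scalerDr scalerA scalerDl addrACA.
have Ku : K u by exists 1, 0; rewrite scale1r addr0.
have KH v : H v -> K v by move=> Hv; exists 0, v; rewrite scale0r add0r.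
have [||psi lin ext] := @linear_extension K co.
- by split => //; apply: KH.
- move=> a v w Kv Kw; apply: co_uniq; first exact: Klin.
  have := Hlin a _ _ (hco _ Kv) (hco _ Kw).
  by rewrite scalerBr scalerA scalerDl opprD addrACA.
exists psi; split => //.
- move=> v Hv; rewrite ext; last exact: KH.
  by apply: co_uniq; [exact: KH|rewrite scale0r subr0].
- by rewrite ext//; apply: co_uniq => //; rewrite scale1r subrr.
Qed.

End linear_extension.

(** * Lagrangian relations attached to quadratic forms *)

Section lagrangian.
Variables (F : finFieldType) (mu nu : option nat).
Implicit Types (H : set (Vd F mu * Vd F nu)) (Q : Vd F mu * Vd F nu -> F).
Implicit Types (h k : Vd F mu * Vd F nu) (p q : V2 F mu * V2 F nu).
Implicit Types S T : set (V2 F mu * V2 F nu).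

Definition base p : Vd F mu * Vd F nu := (p.1.1, p.2.1).

Definition cpair h p : F := dot h.1 p.1.2 - dot h.2 p.2.2.

Lemma base_lin a p q : base (a *: p + q) = a *: base p + base q.
Proof. by []. Qed.

Lemma cpair_linl a h k p : cpair (a *: h + k) p = a * cpair h p + cpair k p.
Proof. by rewrite /cpair !dot_linl; ring. Qed.

Lemma cpair_linr a h p q : cpair h (a *: p + q) = a * cpair h p + cpair h q.
Proof. by rewrite /cpair !dot_linr; ring. Qed.

Lemma cpairDl h k p : cpair (h + k) p = cpair h p + cpair k p.
Proof. by rewrite /cpair !dotDl; ring. Qed.

Lemma cpairDr h p q : cpair h (p + q) = cpair h p + cpair h q.
Proof. by rewrite /cpair !dotDr; ring. Qed.

Lemma cpair0l p : cpair 0 p = 0.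
Proof. by rewrite /cpair !dot0l subr0. Qed.

Lemma rel_formE p q : rel_form p q = cpair (base p) q - cpair (base q) p.
Proof. by rewrite /rel_form !sympE /cpair /=; ring. Qed.

Lemma cpair_functional (psi : Vd F mu * Vd F nu -> F) :
  (forall a h k, psi (a *: h + k) = a * psi h + psi k) ->
  exists c d, forall h, psi h = dot h.1 c - dot h.2 d.
Proof.
move=> lin.
have [c cE] : exists c, forall y, psi (y, 0) = dot y c.
  apply: dot_functional => a x y; rewrite -lin; congr psi.
  by apply: injective_projections => /=; rewrite ?scaler0 ?addr0.
have [d dE] : exists d, forall x, psi (0, x) = dot x d.
  apply: dot_functional => a x y; rewrite -lin; congr psi.
  by apply: injective_projections => /=; rewrite ?scaler0 ?addr0.
exists c, (- d) => -[y x]; rewrite /= dotNr opprK -cE -dE.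
rewrite -[psi (y, 0)]mul1r -lin scale1r; congr psi.
by apply: injective_projections => /=; rewrite ?addr0 ?add0r.
Qed.

(** The relation attached to (H, Q): the equation says that the functional
    B(-, k) on [H], for the polar form B of [Q] at the discrete part k of [p],
    is the one represented by the continuous part of [p]. *)
Definition lagr H Q : set (V2 F mu * V2 F nu) :=
  [set p | H (base p) /\ forall h, H h ->
     Q (h + base p) - Q h - Q (base p) = cpair h p].

Section quadratic.
Variables (H : set (Vd F mu * Vd F nu)) (Q : Vd F mu * Vd F nu -> F).
Hypotheses (sH : subspace_set H) (qQ : quadratic_form_on H Q).

Lemma polar0 h : H h -> Q (h + 0) - Q h - Q 0 = 0.
Proof.
move=> Hh; have := qQ.1 0 h Hh; rewrite scale0r expr0n mul0r addr0 => ->.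
by rewrite subrr subr0.
Qed.

(** B(-, k) is a functional on [H]; it extends to the whole discrete space,
    where it is represented by a continuous part. *)
Lemma lagr_over k : H k -> exists2 p, lagr H Q p & base p = k.
Proof.
move=> Hk; pose phi h := Q (h + k) - Q h - Q k.
have [|psi lin ext] := @linear_extension _ _ H phi sH.
  by move=> a u v Hu Hv; rewrite /phi qQ.2.
have [c [d cdE]] := cpair_functional lin.
exists ((k.1, c), (k.2, d)); last by case: (k).
split; first by rewrite /base -surjective_pairing.
move=> h Hh; rewrite /base -surjective_pairing.
by rewrite -/(phi h) -ext// cdE.
Qed.

Lemma lagr_subspace : subspace_set (lagr H Q).
Proof.
have [H0 Hlin] := sH; have [_ bQ] := qQ.
have symQ u v : Q (u + v) - Q u - Q v = Q (v + u) - Q v - Q u.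
  by rewrite (addrC u); ring.
split=> [|a p q [Hp pE] [Hq qE]].
  split=> // h Hh; have -> : base 0 = 0 by [].
  by rewrite polar0// /cpair !dot0r subr0.
rewrite /lagr /= base_lin; split; first exact: Hlin.
move=> h Hh; rewrite symQ bQ// -(symQ h (base p)) -(symQ h (base q)).
by rewrite pE// qE// cpair_linr.
Qed.

(** For p and q in the relation, rel_form p q = B(k_p, k_q) - B(k_q, k_p) = 0.
    Conversely, if p is orthogonal to the relation, its discrete part lies in H:
    otherwise a functional that vanishes on H and not at that part would be the
    continuous part of an element, over 0, not orthogonal to p. Then
    orthogonality to an element over each h in H is the equation
    defining the relation. *)
Lemma lagr_maximal : maximal_isotropic (lagr H Q).
Proof.
have iso : isotropic (lagr H Q).
  split; first exact: lagr_subspace.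
  move=> p q [Hp pE] [Hq qE]; rewrite rel_formE -pE// -qE//.
  by rewrite (addrC (base p)); ring.
split=> // S [sS iS] TS; apply/seteqP; split => // p Sp.
have formE q : lagr H Q q -> cpair (base p) q = cpair (base q) p.
  by move=> /TS Sq; apply/eqP; rewrite -subr_eq0 -rel_formE iS.
have Hp : H (base p).
  apply: contrapT => nHp.
  have [psi [lin psi0 psi1]] := separating_functional sH nHp.
  have [c [d cdE]] := cpair_functional lin.
  have qT : lagr H Q ((0, c), (0, d)).
    split; first exact: sH.1.
    move=> h Hh; have -> : base ((0, c), (0, d)) = 0 by [].
    rewrite /cpair /= -cdE psi0//.
    exact: polar0.
  have := formE _ qT; rewrite [RHS]cpair0l.
  rewrite -[cpair _ _]/(dot (base p).1 c - dot (base p).2 d) -cdE psi1.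
  by move/eqP; rewrite oner_eq0.
split => // h Hh; have [q qT qh] := lagr_over Hh.
rewrite -qh -formE// -qT.2//.
by rewrite (addrC (base p)); ring.
Qed.

End quadratic.

Section structure.
Variable T : set (V2 F mu * V2 F nu).
Hypotheses (two : 2%:R != 0 :> F).

(** Set Q(k) = (k.c) / 2 for any element of [T] with discrete part k and
    continuous part c. The choice of c does not matter: two choices differ by an
    element of [T] over 0, which is orthogonal to [T]. By isotropy k.c' = k'.c
    for two elements of [T], so the polar form of [Q] is k.c', and [T] is
    contained in the relation attached to [Q], whence equality by maximality. *)
Lemma maximal_isotropic_lagr : maximal_isotropic T ->
  exists Q, quadratic_form_on [set base p | p in T] Q /\
            T = lagr [set base p | p in T] Q.
Proof.
set H := [set base p | p in T] => -[[[T0 Tlin] isoT] maxT].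
have sH : subspace_set H.
  split; first by exists 0.
  move=> a _ _ [p Tp <-] [q Tq <-]; exists (a *: p + q) => //; exact: Tlin.
have /choice[sec secP] : forall k, exists p, H k -> T p /\ base p = k.
  move=> k; have [[p Tp pk]|nH] := pselect (H k); first by exists p.
  by exists 0 => /nH.
have symT p q : T p -> T q -> cpair (base p) q = cpair (base q) p.
  by move=> Tp Tq; apply/eqP; rewrite -subr_eq0 -rel_formE isoT.
have secE h p : H h -> T p -> cpair h (sec (base p)) = cpair h p.
  move=> Hh Tp; have [Th hE] := secP _ Hh.
  have [|Tb bE] := secP (base p); first by exists p.
  by rewrite -[in LHS]hE -[in RHS]hE !(symT (sec h))// bE.
pose Q k := 2%:R^-1 * cpair k (sec k).
have QE p : T p -> Q (base p) = 2%:R^-1 * cpair (base p) p.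
  by move=> Tp; rewrite /Q secE//; exists p.
have BE p q : T p -> T q ->
    Q (base p + base q) - Q (base p) - Q (base q) = cpair (base p) q.
  move=> Tp Tq; have -> : base p + base q = base (p + q) by [].
  have Tpq : T (p + q) by rewrite -[p]scale1r; exact: Tlin.
  rewrite !QE// cpairDr; have -> : base (p + q) = base p + base q by [].
  rewrite !cpairDl -(symT p q)//.
  by field.
have qQ : quadratic_form_on H Q.
  split=> [a _ [p Tp <-]|a _ _ _ [p Tp <-] [q Tq <-] [r Tr <-]].
    have Tap : T (a *: p) by rewrite -[a *: p]addr0; exact: Tlin.
    have -> : a *: base p = base (a *: p) by [].
    rewrite !QE//; have -> : base (a *: p) = a *: base p by [].
    rewrite -[a *: base p]addr0 -[a *: p]addr0 cpair_linl cpair_linr.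
    by rewrite cpair0l /cpair !dot0r; ring.
  rewrite -!base_lin BE//; last exact: Tlin.
  by rewrite base_lin cpair_linl !BE.
exists Q; split => //; apply/esym/maxT; last first.
  move=> p Tp; split; first by exists p.
  by move=> _ [q Tq <-]; rewrite BE.
by have [] := lagr_maximal sH qQ.
Qed.

End structure.

End lagrangian.

Section transpose.
Variables (F : finFieldType) (mu nu : option nat).

(** Transposition exchanges kernel with indefinity and domain with image, so
    each topological statement below is proved on one side only; [Q] changes
    sign because the form on the sum of the two symplectic spaces does. *)
Definition transp (X Y : Type) (T : set (X * Y)) : set (Y * X) :=
  [set p | T (p.2, p.1)].

Lemma transp_lagr (H : set (Vd F mu * Vd F nu)) Q :
  transp (lagr H Q) = lagr (transp H) (fun k => - Q (k.2, k.1)).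
Proof.
have negE (A B C D E : F) : - A - - B - - C = D - E <-> A - B - C = E - D.
  have -> : - A - - B - - C = - (A - B - C) by ring.
  by rewrite -[D - E]opprB; split=> [/oppr_inj|->].
apply/seteqP; split => p [Hp pE]; split => // h Hh.
  by apply/negE; exact: (pE (h.2, h.1)).
case: h Hh => y x Hh; apply/negE; exact: (pE (x, y)).
Qed.

Lemma transp_quadratic (H : set (Vd F mu * Vd F nu)) Q :
  quadratic_form_on H Q ->
  quadratic_form_on (transp H) (fun k => - Q (k.2, k.1)).
Proof.
move=> [Q2 QB]; split=> [a u Hu|a u v w Hu Hv Hw] /=.
  by rewrite mulrN -Q2.
have E (A B C : F) : - A - - B - - C = - (A - B - C) by ring.
rewrite !E mulrN -opprD; congr (- _).
exact: (QB a (u.2, u.1) (v.2, v.1) (w.2, w.1)).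
Qed.

Lemma transp_subspace (X Y : lmodType F) (H : set (X * Y)) :
  subspace_set H -> subspace_set (transp H).
Proof.
by move=> [H0 Hlin]; split=> // a u v Hu Hv; exact: (Hlin a _ _ Hu Hv).
Qed.

End transpose.

(** * Topology of V_(2 mu) *)

Lemma pi_quotient_eq (V : zmodType) (Z : set V) u v :
  \pi_(quotient_by Z)%qT u = \pi_(quotient_by Z)%qT v <->
  acoset Z u = acoset Z v.
Proof.
split=> [|h].
  by move=> /(introT (@eqquotP _ _ (quotient_by Z) u v))/asboolP.
by apply: (elimT (@eqquotP _ _ (quotient_by Z) u v)); exact/asboolP.
Qed.

Section topology.
Variables (F : finFieldType) (mu : option nat).
Implicit Types (v w : V2 F mu) (c d : Vc F mu) (Z : set (V2 F mu)).

Lemma coord_near c j : \forall c' \near c, c' j = c j.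
Proof.
have := @proj_continuous (Idx mu) (fun=> discrete_topology F) j c [set c j].
by apply; exact: (@discrete_set1 (discrete_topology F)).
Qed.

Lemma nbhs_cylinder v (s : seq (Idx mu)) :
  \forall v' \near v, v'.1 = v.1 /\ forall j, j \in s -> v'.2 j = v.2 j.
Proof.
case: v => x c /=.
have nc : \forall c' \near c, forall j, j \in s -> c' j = c j.
  elim: s => [|i s IH]; first exact: filterE.
  apply: filterS2 (coord_near c i) IH => c' ci cs j.
  by rewrite inE => /predU1P[->|/cs].
exists ([set x], [set c' | forall j, j \in s -> c' j = c j]) => /=; last first.
  by move=> [x' c'] /= [-> cc].
split=> //; exact: (@discrete_set1 (discrete_topology (Vd F mu))).
Qed.

(** The filter generated by the cylinders converges to 0 in each coordinate,
    hence in the product topology, so it contains every neighbourhood of 0. *)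
Lemma nbhs0_cylinder Z : nbhs (0 : V2 F mu) Z -> exists s : seq (Idx mu),
  forall c, (forall j, j \in s -> c j = 0) -> Z (0, c).
Proof.
move=> -[[A B] [/= A0 B0] AB].
pose cyl (s : seq (Idx mu)) : set (Vc F mu) :=
  [set c | forall j, j \in s -> c j = 0].
pose G : set_system (Vc F mu) := filter_from setT cyl.
have GF : Filter G.
  apply: filter_from_filter; first by exists [::].
  move=> s t _ _; exists (s ++ t) => // c cst.
  by split=> j js; apply: cst; rewrite mem_cat js ?orbT.
have G0 : G --> (0 : Vc F mu).
  apply/cvg_sup => j U /=.
    rewrite (@nbhsE (initial_topology
      (fun f : Idx mu -> discrete_topology F => f j))) => -[V [[W _ <-] W0] VU].
  exists [:: j] => // c cj; apply: VU => /=.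
  by have /= -> : c j = 0; [apply: cj; rewrite inE|].
have [s _ sB] := G0 _ B0.
exists s => c cs; apply: AB; split; last exact: sB.
exact: nbhs_singleton A0.
Qed.

Lemma compact_Vc : compact [set: Vc F mu].
Proof.
have -> : [set: Vc F mu] =
    [set f | forall i : Idx mu, [set: discrete_topology F] (f i)].
  by apply/seteqP; split.
apply: (@tychonoff (Idx mu) (fun=> discrete_topology F) (fun=> setT)) => i.
exact/finite_compact/(@finite_finset F setT).
Qed.

(** [Z] is the inverse image of a point of the discrete quotient, hence it is
    open. *)
Lemma codiscrete_cylinder Z : codiscrete Z -> exists s : seq (Idx mu),
  forall c, (forall j, j \in s -> c j = 0) -> Z (0, c).
Proof.
move=> [sZ _ dZ]; apply: nbhs0_cylinder.
have oU : open [set v | acoset Z v = acoset Z 0].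
  rewrite [X in open X](_ : _ = [set v |
      \pi_(quotient_by Z)%qT v = \pi_(quotient_by Z)%qT 0]).
    exact: (dZ [set q | q = \pi_(quotient_by Z)%qT 0]).
  by apply/seteqP; split => v /pi_quotient_eq.
apply: filterS (open_nbhs_nbhs (conj oU erefl)) => v v0.
have : acoset Z v v by exists 0; rewrite ?addr0//; exact: sZ.1.
by rewrite v0 => -[z Zz /=]; rewrite add0r => <-.
Qed.

(** A subspace that contains a cylinder is open, as are its cosets; so every
    union of cosets is open, and so is the complement of [Z]. *)
Lemma cylinder_codiscrete Z (s : seq (Idx mu)) : subspace_set Z ->
  (forall c, (forall j, j \in s -> c j = 0) -> Z (0, c)) -> codiscrete Z.
Proof.
move=> sZ cZ; have [Z0 Zlin] := sZ.
have ZD u v : Z u -> Z v -> Z (u + v).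
  by move=> Zu Zv; rewrite -[u]scale1r; exact: Zlin.
have ZN u : Z u -> Z (- u).
  by move=> Zu; rewrite -[- u]addr0 -scaleN1r; exact: Zlin.
have near_coset v : \forall w \near v, Z (w - v).
  apply: filterS (nbhs_cylinder v s) => -[x c] /= [-> cs].
  have -> : (v.1, c) - v = (0, c - v.2).
    by case: v cs => y d _; congr pair; rewrite subrr.
  by apply: cZ => j /cs cj; change ((c j : F) - v.2 j = 0); rewrite cj subrr.
split=> //.
  rewrite -[Z]setCK closedC openE => v nZv.
  apply: filterS (near_coset v) => w Zwv Zw; apply: nZv.
  have -> : v = w - (w - v) by rewrite opprB addrC subrK.
  exact: ZD Zw (ZN _ Zwv).
move=> U; change (open (\pi_(quotient_topology (quotient_by Z))%qT @^-1` U)).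
rewrite openE => v Uv; apply: filterS (near_coset v) => w Zwv.
suff e : \pi_(quotient_by Z)%qT w = \pi_(quotient_by Z)%qT v.
  by move: Uv; rewrite /= /interior /= => Uv; rewrite -e in Uv.
apply/pi_quotient_eq; apply/seteqP; split => _ [z Zz <-].
  by exists (w - v + z); [exact: ZD|rewrite addrA addrCA subrr addr0].
by exists (v - w + z); [apply: ZD => //; rewrite -opprB; exact: ZN
  |rewrite addrA addrCA subrr addr0].
Qed.

(** Each equation involves finitely many coordinates, so its failure is
    inherited by a whole cylinder. *)
Lemma closed_dot_eq (I : Type) (D : set I) (Y : set (Vd F mu))
    (f : I -> Vd F mu -> F) (g : I -> Vd F mu) :
  closed [set v : V2 F mu | Y v.1 /\ forall i, D i -> f i v.1 = dot (g i) v.2].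
Proof.
set Z := [set v | _]; rewrite -[Z]setCK closedC openE => v.
move=> /not_andP[nY|/existsNP[i /not_implyP[Di ne]]].
  by apply: filterS (nbhs_cylinder v [::]) => w [wv _] [Yw _]; rewrite wv in Yw.
have [s us hs] := vd_supp (g i).
apply: filterS (nbhs_cylinder v s) => w [wv ws] [_ /(_ i Di)].
rewrite wv => e; apply: ne; rewrite e !(dotE (s := s))//.
by rewrite big_seq [RHS]big_seq; apply: eq_bigr => j /ws ->.
Qed.

Lemma compact_finite_base (Y : set (Vd F mu)) (Z : set (V2 F mu)) :
  finite_set Y -> closed Z -> (forall v, Z v -> Y v.1) -> compact Z.
Proof.
move=> fY cZ ZY; apply: (subclosed_compact cZ) (_ : Z `<=` Y `*` setT).
  exact: compact_setX (finite_compact fY) compact_Vc.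
by move=> v /ZY.
Qed.

End topology.

(** * Finiteness, and perfect Lagrangian relations *)

Section finiteness.
Variable F : finFieldType.

Lemma finite_dim_finite (V : lmodType F) (K : set V) :
  finite_dim K -> finite_set K.
Proof.
move=> [n [e ->]].
pose g (c : {ffun 'I_n -> F}) := \sum_(k < n) c k *: e k.
apply: (@sub_finite_set _ _ (g @` setT)); last first.
  by apply: finite_image; exact: finite_finset.
move=> _ [c _ <-]; exists [ffun k => c k] => //.
by rewrite /g; apply: eq_bigr => k _; rewrite ffunE.
Qed.

(** All the elements of [K] together form a generating family. *)
Lemma finite_finite_dim (V : lmodType F) (K : set V) :
  subspace_set K -> finite_set K -> finite_dim K.
Proof.
move=> [K0 Klin] /finite_seqP[s sK].
exists (size s), (fun k => nth 0 s k); apply/seteqP; split.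
  move=> u Ku; have us : u \in s by have : [set` s] u by rewrite -sK.
  have lt : (index u s < size s)%N by rewrite index_mem.
  exists (fun k => (k == Ordinal lt)%:R) => //.
  rewrite (bigD1 (Ordinal lt))//= eqxx scale1r nth_index// big1 ?addr0//.
  by move=> k /negPf ->; rewrite scale0r.
move=> _ [c _ <-]; elim/big_rec: _ => // k v _ Kv; apply: Klin => //.
by rewrite sK /= mem_nth.
Qed.

Variable mu : option nat.
Implicit Types (x y : Vd F mu) (c : Vc F mu).

Lemma finite_common_supp (S : set (Vd F mu)) : finite_set S ->
  exists s : seq (Idx mu), forall x, S x -> forall j, j \notin s -> x j = 0.
Proof.
move=> /finite_seqP[l ->]; elim: l => [|y l [s hs]]; first by exists [::].
have [t _ ht] := vd_supp y; exists (t ++ s) => x /=.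
rewrite inE => /predU1P[->|xl] j; rewrite mem_cat negb_or => /andP[jt js].
  exact: ht.
exact: hs.
Qed.

Lemma finite_bounded_supp m :
  finite_set [set x : Vd F mu | forall j, (m <= pickle j)%N -> x j = 0].
Proof.
pose r x : {ffun 'I_m -> F} :=
  [ffun k : 'I_m => (oapp x (0 : F) (pickle_inv k : option (Idx mu)) : F)].
set B := [set x | _].
have injr : {in B &, injective r}.
  move=> x y /set_mem xB /set_mem yB /ffunP rxy; apply: vd_eq => j.
  have [/[dup] /xB -> /yB -> //|jm] := leqP m (pickle j).
  by have := rxy (Ordinal jm); rewrite !ffunE /= pickleK_inv.
by rewrite -(eq_finite_set (inj_card_eq injr)); exact: finite_finset.
Qed.

(** Cantor's diagonal argument: were [S] infinite, one could choose the
    coordinates of [c] one after another so as to violate the n-th candidate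
    on the n-th of a sequence of elements of [S] with growing supports. *)
Lemma countable_restrictions_finite (S : set (Vd F mu)) (s : seq (Idx mu))
    (phi : nat -> Vd F mu -> F) :
  (forall c, (forall j, j \in s -> c j = 0) ->
     exists n, forall x, S x -> dot x c = phi n x) ->
  finite_set S.
Proof.
move=> hphi; apply: contrapT => infS.
have far m : exists x j, [/\ S x, (m <= pickle j)%N & x j != 0].
  apply: contrapT => none; apply: infS.
  apply: sub_finite_set (finite_bounded_supp m).
  move=> x Sx j mj; apply/eqP/negPn/negP => xj; apply: none.
  by exists x, j.
pose ext (n : nat) (a b : nat * Vc F mu) := [/\ (a.1 < b.1)%N,
  forall j, (pickle j < a.1)%N -> b.2 j = a.2 j &
  exists x, [/\ S x, forall j, (b.1 <= pickle j)%N -> x j = 0 &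
                dot x b.2 != phi n x]].
have /choice[next nextP] : forall na : nat * (nat * Vc F mu),
    exists b, ext na.1 na.2 b.
  move=> [n [m c]]; have [x [j [Sx mj xj]]] := far m.
  have [t _ ht] := vd_supp x.
  (* The new coordinate is chosen so that the pairing with x is phi n x + 1. *)
  exists ((m + \max_(i <- t) pickle i).+1,
          ((phi n x + 1 - dot x c) / (x j : F)) *: kron_c F j + c).
  split=> /=; first by rewrite ltnS leq_addr.
    move=> i im; rewrite vcE /kron_c; have [ij|_] := eqVneq i j.
      by move: im; rewrite ij ltnNge mj.
    by rewrite mulr0 add0r.
  exists x; split=> // [i ti|].
    apply: ht; apply: contraTN ti => ti; rewrite -ltnNge ltnS.
    by rewrite (leq_trans _ (leq_addl _ _))// (leq_bigmax_seq (F := pickle)).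
  rewrite dot_linr dot_kron_c divfK// subrK -subr_eq0 addrC addrA addNr add0r.
  exact: oner_neq0.
(* [st n] is a pair (m, c): the coordinates of [c] of rank below [m] are final,
   and they already violate the first [n] candidates. *)
pose st := fix st n := if n is n'.+1 then next (n', st n')
  else ((\max_(i <- s) pickle i).+1, 0 : Vc F mu).
have stP n : ext n (st n) (st n.+1) by exact: (nextP (n, st n)).
have st_ge n : (n <= (st n).1)%N.
  by elim: n => // n IH; apply: leq_ltn_trans IH _; case: (stP n).
have st_mono n k j : (pickle j < (st n).1)%N ->
    (pickle j < (st (k + n)%N).1)%N /\ (st (k + n)%N).2 j = (st n).2 j.
  move=> jn; elim: k => [//|k [IH1 IH2]]; rewrite addSn.
  have [lt eqj _] := stP (k + n)%N; split; first exact: ltn_trans lt.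
  by rewrite eqj.
pose c : Vc F mu := fun j => (st (pickle j).+1).2 j.
have cE n j : (pickle j < (st n).1)%N -> c j = (st n).2 j.
  move=> jn; have [_ e1] := st_mono _ (pickle j).+1 _ jn.
  have [_ e2] := st_mono _ n j (st_ge (pickle j).+1).
  by rewrite /c -e1 addnC e2.
have [|n nP] := hphi c.
  move=> j js; rewrite (cE 0%N)//= ltnS.
  exact: (leq_bigmax_seq (F := pickle)).
have [_ _ [x [Sx x0 /eqP]]] := stP n; apply; rewrite -nP//.
have [t ut ht] := vd_supp x; rewrite !(dotE (s := t))//.
apply: eq_bigr => j _; have [/x0 ->|jn] := leqP (st n.+1).1 (pickle j).
  by rewrite !mul0r.
by rewrite (cE n.+1).
Qed.

End finiteness.

Section kernels.
Variables (F : finFieldType) (mu nu : option nat).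
Implicit Types (T : set (V2 F mu * V2 F nu)).
Implicit Types (H : set (Vd F mu * Vd F nu)) (Q : Vd F mu * Vd F nu -> F).

(** The image is codiscrete, so for every c that vanishes on some finite set
    of coordinates there is a (v, (0, c)) in [T]. If also (0, b; x, d) lies in
    [T], isotropy gives x.c = - v^d.b: on the set of all such x the functional
    of c is determined by v^d, which ranges over a countable set. Uncountably
    many c would restrict to different functionals if the set of the x were
    infinite. *)
Lemma finite_indef_base T : isotropic T -> codiscrete (rel_im T) ->
  finite_set [set x | [set base p | p in T] (0, x)].
Proof.
move=> [_ isoT] /codiscrete_cylinder[s sP].
set S := [set x | _].
have [e eP] := vd_countable F mu.
have /choice[sec secP] : forall x, exists p, S x -> T p /\ base p = (0, x).
  move=> x; have [[p Tp pE]|nS] := pselect (S x); first by exists p.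
  by exists 0 => /nS.
apply: (@countable_restrictions_finite _ _ S s
  (fun n x => - dot (e n) (sec x).1.2)) => c /sP[[y d] Tc].
have [n ny] := eP y; exists n => x /secP[Tx xE].
have := isoT _ _ Tx Tc; rewrite rel_formE xE /cpair /= ny !dot0l.
by rewrite sub0r subr0 => /eqP; rewrite subr_eq0 => /eqP <-; rewrite opprK.
Qed.

Lemma lagr_ker_compact H Q : finite_set [set y | H (y, 0)] ->
  compact (rel_ker (lagr H Q)).
Proof.
move=> fH; apply: (compact_finite_base fH); last by move=> v [].
rewrite [X in closed X](_ : _ = [set v : V2 F mu | [set y | H (y, 0)] v.1 /\
  forall h, H h -> Q (h + (v.1, 0)) - Q h - Q (v.1, 0) = dot h.1 v.2]).
  exact: (@closed_dot_eq _ _ _ H [set y | H (y, 0)]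
    (fun h y => Q (h + (y, 0)) - Q h - Q (y, 0)) fst).
by apply/seteqP; split => v [Hv vP]; split => // h /vP;
  rewrite /cpair /= dot0r subr0.
Qed.

(** Over the discrete part 0, (0, c) is in the image when x.c, as a function of
    (y, x) in [H], depends on y only. That holds for every c that vanishes on
    the supports of the finitely many x with (0, x) in [H]. *)
Lemma lagr_im_codiscrete H Q : subspace_set H -> quadratic_form_on H Q ->
  finite_set [set x | H (0, x)] -> codiscrete (rel_im (lagr H Q)).
Proof.
move=> sH qQ /finite_common_supp[s sP]; have [H0 Hlin] := sH.
have [T0 Tlin] := lagr_subspace sH qQ.
apply: (@cylinder_codiscrete _ _ _ s).
  split; first by exists 0.
  by move=> a w w' [v Tv] [v' Tv']; exists (a *: v + v'); exact: Tlin Tv Tv'.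
move=> c cs.
pose P : set (Vd F mu) := [set y | exists x, H (y, x)].
have /choice[sec secP] : forall y, exists x, P y -> H (y, x).
  by move=> y; have [[x Hx]|nP] := pselect (P y); [exists x|exists 0 => /nP].
have secE y x : H (y, x) -> dot (sec y) c = dot x c.
  move=> Hyx; have Hs : H (y, sec y) by apply: secP; exists x.
  have := Hlin (-1) _ _ Hs Hyx; rewrite scaleN1r => Hd.
  have /sP d0 : H (0, x - sec y).
    move: Hd; congr H; apply: injective_projections; rewrite /= ?addNr//.
    by rewrite addrC.
  apply/eqP; rewrite -subr_eq0 -dotNl -dotDl -opprB dotNl oppr_eq0.
  have [t ut ht] := vd_supp (x - sec y); rewrite (dotE (s := t))//.
  rewrite big1// => j _; have [js|/d0 ->] := boolP (j \in s).
    by rewrite cs// mulr0.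
  by rewrite mul0r.
have [||psi lin ext] := @linear_extension _ _ P (fun y => dot (sec y) c).
- split; first by exists 0.
  by move=> a y y' [x Hx] [x' Hx']; exists (a *: x + x'); exact: Hlin Hx Hx'.
- move=> a y y' Py Py'; rewrite -dot_linl; apply: secE.
  exact: Hlin (secP _ Py) (secP _ Py').
have [d dE] := dot_functional lin.
exists (0, d); split => //= -[y x] Hh.
have -> : base ((0, d), (0, c)) = 0 :> Vd F mu * Vd F nu by [].
rewrite (polar0 qQ)// /cpair /= -dE ext; last by exists x.
by rewrite (secE _ _ Hh) subrr.
Qed.

End kernels.

Section perfect.
Variables (F : finFieldType) (mu nu : option nat).

Lemma gaussian_data_finite (H : set (Vd F mu * Vd F nu)) Q :
  gaussian_data H Q ->
  finite_set [set y | H (y, 0)] /\ finite_set [set x | H (0, x)].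
Proof.
move=> [_ /finite_dim_finite f1 /finite_dim_finite f2 _]; split.
  apply: sub_finite_set (finite_image fst f2) => y Hy.
  by exists (y, 0).
apply: sub_finite_set (finite_image snd f1) => x Hx.
by exists (0, x).
Qed.

Lemma lagr_perfect (H : set (Vd F mu * Vd F nu)) Q :
  gaussian_data H Q -> perfect_lagrangian (lagr H Q).
Proof.
move=> GD; have [f2 f1] := gaussian_data_finite GD.
have [sH _ _ qQ] := GD.
have sHt := transp_subspace sH; have qQt := transp_quadratic qQ.
have imE : rel_dom (lagr H Q) = rel_im (transp (lagr H Q)) by [].
have indefE : rel_indef (lagr H Q) = rel_ker (transp (lagr H Q)) by [].
split; first exact: lagr_maximal.
  by rewrite indefE transp_lagr; split; exact: lagr_ker_compact.
by rewrite imE transp_lagr; split; exact: lagr_im_codiscrete.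
Qed.

Lemma perfect_lagr (T : set (V2 F mu * V2 F nu)) : 2%:R != 0 :> F ->
  perfect_lagrangian T -> exists H Q, gaussian_data H Q /\ T = lagr H Q.
Proof.
move=> two [mT _ [imT domT]]; have [Q [qQ TE]] := maximal_isotropic_lagr two mT.
exists [set base p | p in T], Q; split => //.
have [[[T0 Tlin] isoT] _] := mT.
have sH : subspace_set [set base p | p in T].
  split; first by exists 0.
  by move=> a _ _ [p Tp <-] [q Tq <-]; exists (a *: p + q) => //; exact: Tlin.
have f1 := finite_indef_base (conj (conj T0 Tlin) isoT) imT.
have isoTt : isotropic (transp T).
  split; first exact: transp_subspace.
  move=> p q Tp Tq; have := isoT _ _ Tp Tq; rewrite /rel_form /= => /eqP.
  by rewrite subr_eq0 => /eqP ->; rewrite subrr.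
have f2 := @finite_indef_base _ _ _ (transp T) isoTt domT.
have subI (K : set (Vd F mu * Vd F nu)) : subspace_set K ->
    subspace_set ([set base p | p in T] `&` K).
  move=> [K0 Klin]; have [H0 Hlin] := sH; split => // a u v [Hu Ku] [Hv Kv].
  by split; [exact: Hlin|exact: Klin].
split => //; apply: finite_finite_dim.
- apply: subI; split => // a u v /= -> ->; by rewrite scaler0 addr0.
- apply: sub_finite_set (finite_image (fun x => (0, x)) f1).
  by move=> [y x] [Hyx /= y0]; exists x; rewrite /= ?y0// -y0.
- apply: subI; split => // a u v /= -> ->; by rewrite scaler0 addr0.
- apply: sub_finite_set (finite_image (fun y => (y, 0)) f2).
  move=> [y x] [[p Tp [py px]] /= x0]; exists y; last by rewrite x0.
  exists (p.2, p.1); first by rewrite /transp /= -surjective_pairing.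
  by rewrite /base /= py px x0.
Qed.

End perfect.

(** * Bounded operators between l^2 spaces *)

Section hilbert.
Variable R : realType.

Lemma ell2_eq (X : choiceType) (f g : ell2 R X) :
  (forall x, f x = g x) -> f = g.
Proof. by move=> fg; apply: val_inj; apply/funext => x; exact: fg. Qed.

Lemma normc_term_ge0 (X : Type) (f : X -> R[i]) x :
  (0 <= ((normc (f x)) ^+ 2)%:E)%E.
Proof. by rewrite lee_fin sqr_ge0. Qed.

(** The crude constant [2 ^ n] in place of [n] makes the induction immediate,
    from the inequality |a + b|^2 <= 2 |a|^2 + 2 |b|^2. *)
Lemma normc_sum_sq (I : Type) (s : seq I) (u : I -> R[i]) :
  normc (\sum_(i <- s) u i) ^+ 2 <=
  2%:R ^+ size s * \sum_(i <- s) normc (u i) ^+ 2 :> R.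
Proof.
elim: s => [|i s IH]; first by rewrite !big_nil Normc.normc0 expr0n mulr0.
rewrite !big_cons [size _]/= [2%:R ^+ _]exprS.
have tri := le_normcD (u i) (\sum_(j <- s) u j).
set A := normc (u i + _) in tri *; set b := normc (u i) in tri *.
set S := normc (\sum_(j <- s) u j) in tri IH *.
set q := \sum_(j <- s) normc (u j) ^+ 2 in IH *.
have A0 : 0 <= A by exact: normc_ge0.
have b0 : 0 <= b by exact: normc_ge0.
have S0 : 0 <= S by exact: normc_ge0.
have e1 : 1 <= 2%:R ^+ size s :> R by rewrite exprn_ege1// ler1n.
move: (2%:R ^+ size s) IH e1 => e IH e1.
have h1 : A ^+ 2 <= (b + S) ^+ 2 by rewrite lerXn2r ?nnegrE ?addr_ge0.
have h2 : b ^+ 2 <= e * b ^+ 2 by rewrite ler_peMl// sqr_ge0.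
have h3 := sqr_ge0 (b - S).
lra.
Qed.

Variable X : choiceType.

Lemma sqsum_fin (f : ell2 R X) : sqsum f \is a fin_num.
Proof.
have : (f : X -> R[i]^o) \in @sqsummable R X by exact: valP.
rewrite /sqsummable unfold_in => fo; rewrite ge0_fin_numE//.
by apply: esum_ge0 => x _; exact: normc_term_ge0.
Qed.

Lemma normc_le_sqsum (f : ell2 R X) x : ((normc (f x) ^+ 2)%:E <= sqsum f)%E.
Proof.
apply: esum_ge; exists [set x]; first by split; [exact: finite_set1|].
by rewrite fsbig_set1.
Qed.

Lemma ell2_norm_sq (f : ell2 R X) : ((ell2_norm f ^+ 2)%:E = sqsum f)%E.
Proof.
rewrite sqr_sqrtr ?fineK ?sqsum_fin// fine_ge0//.
by apply: esum_ge0 => x _; exact: normc_term_ge0.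
Qed.

Lemma ell2_norm_ge0 (f : ell2 R X) : 0 <= ell2_norm f.
Proof. exact: sqrtr_ge0. Qed.

Lemma normc_le_norm (f : ell2 R X) x : normc (f x) <= ell2_norm f.
Proof.
rewrite -(@ler_pXn2r _ 2)// ?nnegrE ?normc_ge0 ?ell2_norm_ge0//.
by rewrite -lee_fin ell2_norm_sq normc_le_sqsum.
Qed.

Lemma delta_sqsummable (y : X) :
  ((fun x => (x == y)%:R) : X -> R[i]^o) \in @sqsummable R X.
Proof.
rewrite /sqsummable unfold_in /sqsum.
rewrite [X in (X < _)%E](_ : _ = \esum_(x in [set y]) 1%:E).
  by rewrite esum_set1 ?lee_fin ?ler01// ltry.
rewrite [RHS]esum_mkcond; apply: eq_esum => x _.
rewrite in_set1; case: eqP => _; first by rewrite Normc.normc1 expr1n.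
by rewrite Normc.normc0 expr0n.
Qed.

Definition delta (y : X) : ell2 R X := MkEll2 (delta_sqsummable y).

(** A finite partial sum of the squares that comes within [e ^ 2] of the total
    leaves less than [e ^ 2] outside of its support. *)
Lemma delta_dense (f : ell2 R X) (s0 : seq X) (e : R) : 0 < e ->
  exists s : seq X, [/\ uniq s, {subset s0 <= s} &
    ell2_norm (f - \sum_(y <- s) (f y : R[i]) *: delta y) <= e].
Proof.
move=> e0; have [_ [A [/finite_seqP[t tE] _] <-] lt] :=
  @ub_ereal_sup_adherent _ _ (e ^+ 2) (exprn_gt0 2 e0) (sqsum_fin f).
pose s := undup (t ++ s0); have us : uniq s by exact: undup_uniq.
exists s; split=> // [y ys|].
  by rewrite mem_undup mem_cat ys orbT.
set g := f - _.
have gE x : g x = (if x \in s then 0 else f x) :> R[i].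
  rewrite /g; have -> : (f - \sum_(y <- s) (f y : R[i]) *: delta y) x =
     f x - (\sum_(y <- s) (f y : R[i]) *: delta y) x by [].
  have -> : (\sum_(y <- s) (f y : R[i]) *: delta y) x =
     \sum_(y <- s) (f y : R[i]) * (x == y)%:R.
    by elim/big_rec2: _ => //= i a b _ <-.
  case: ifPn => xs.
    rewrite (bigD1_seq x)//= eqxx mulr1 big1 ?addr0 ?subrr// => y.
    by rewrite eq_sym => /negPf ->; rewrite mulr0.
  rewrite big_seq big1 ?subr0// => y ys; have [xy|_] := eqVneq x y.
    by rewrite xy ys in xs.
  by rewrite mulr0.
rewrite -(@ler_pXn2r _ 2)// ?nnegrE ?ell2_norm_ge0 ?(ltW e0)//.
rewrite -lee_fin ell2_norm_sq.
have -> : sqsum g = \esum_(x in [set: X] `&` ~` [set` s]) (normc (f x) ^+ 2)%:E.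
  rewrite /sqsum [RHS]esum_mkcondr; apply: eq_esum => x _; rewrite gE in_setC.
  rewrite mem_setE; case: (x \in s) => //.
  by rewrite Normc.normc0 expr0n.
have fE : sqsum f = _ := esumID [set` s] [set: X]
  (fun x => (normc (f x) ^+ 2)%:E)
  (fun x _ => normc_term_ge0 f x).
have le_t : (\sum_(x \in A) (normc (f x) ^+ 2)%:E <=
    \esum_(x in [set: X] `&` [set` s]) (normc (f x) ^+ 2)%:E)%E.
  apply: esum_ge; exists A => //; split; first by rewrite tE; exact: finite_seq.
  by move=> x; rewrite tE /= => xt; split => //=; rewrite mem_undup mem_cat xt.
have {}lt : (sqsum f - (e ^+ 2)%:E < \sum_(x \in A) (normc (f x) ^+ 2)%:E)%E.
  exact: lt.
move: lt (sqsum_fin f); rewrite fE.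
move: (\esum_(x in [set: X] `&` [set` s]) _) le_t => E1 le_t.
move: (\esum_(x in [set: X] `&` ~` [set` s]) _) => E2 /lt_le_trans/(_ le_t).
rewrite fin_numD => + /andP[]; case: E1 {le_t} => // r1; case: E2 => // r2.
move=> lt12 _ _; have : ((r1 + r2 - e ^+ 2)%:E < r1%:E)%E by exact: lt12.
by rewrite lte_fin lee_fin; lra.
Qed.

End hilbert.

Section bounded.
Variables (R : realType) (X Y : choiceType).

(** A bounded operator is determined by its matrix, since finitely supported
    vectors are dense; the row of index [y] is supported by [B], so it acts by
    a finite sum. *)
Lemma bounded_matrix (A : {linear ell2 R X -> ell2 R Y}) (y : Y) (B : seq X) :
  bounded_op A -> uniq B -> (forall x, x \notin B -> A (delta R x) y = 0) ->
  forall f, A f y = \sum_(x <- B) (f x : R[i]) * A (delta R x) y.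
Proof.
move=> [M AM] uB Bz f; apply/eqP; rewrite -subr_eq0; apply/eqP.
set D := _ - _.
suff small e : 0 < e -> normc D <= `|M| * e.
  apply: Normc.eq0_normc; apply/eqP; rewrite eq_le normc_ge0 andbT.
  apply/ler_addgt0Pr => e e0; rewrite add0r.
  have M1 : 0 < `|M| + 1 by rewrite ltr_wpDl.
  apply: le_trans (small (e / (`|M| + 1)) (divr_gt0 e0 M1)) _.
  by rewrite mulrCA ger_pMr// ler_pdivrMr// mul1r lerDl.
move=> e0; have [s [us Bs small]] := delta_dense f B e0.
set h := \sum_(x <- s) _ in small.
have -> : D = A (f - h) y.
  rewrite linearB.
  have -> : (A f - A h) y = A f y - A h y by [].
  congr (_ - _); rewrite /h linear_sum.
  have -> : (\sum_(i <- s) A ((f i : R[i]) *: delta R i)) y =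
     \sum_(i <- s) (f i : R[i]) * A (delta R i) y.
    by elim/big_rec2: _ => //= i a b _ <-; rewrite linearZ.
  rewrite [RHS](bigID (mem B)) /= [X in _ + X]big1 ?addr0; last first.
    by move=> x /Bz ->; rewrite mulr0.
  rewrite -[RHS]big_filter; apply: perm_big; apply: uniq_perm => //.
    exact: filter_uniq.
  by move=> x; rewrite mem_filter; case: (boolP (x \in B)) => // /Bs ->.
apply: le_trans (normc_le_norm _ _) _; apply: le_trans (AM _) _.
apply: le_trans (ler_wpM2r (ell2_norm_ge0 _) (ler_norm M)) _.
exact: ler_wpM2l.
Qed.

Variables (row : Y -> seq X) (K : X -> Y -> R[i]) (N M : nat).
Hypothesis rowU : forall y, uniq (row y).
Hypothesis rowN : forall y, (size (row y) <= N)%N.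
Hypothesis colM : forall x, exists2 s : seq Y, (size s <= M)%N &
  forall y, x \in row y -> y \in s.
Hypothesis K1 : forall x y, normc (K x y) = 1.

Definition matrix_fun (f : X -> R[i]^o) : Y -> R[i]^o :=
  fun y => \sum_(x <- row y) K x y * (f x : R[i]).

(** Exchanging the two summations, each [a x] is counted once for each row that
    contains [x]. *)
Lemma esum_rows (a : X -> R) : (forall x, 0 <= a x) ->
  (\esum_(y in [set: Y]) (\sum_(x <- row y) a x)%:E <=
   M%:R%:E * \esum_(x in [set: X]) (a x)%:E)%E.
Proof.
move=> a0.
have -> : (\esum_(y in [set: Y]) (\sum_(x <- row y) a x)%:E =
   \esum_(y in [set: Y]) \esum_(x in [set` row y]) (a x)%:E)%E.
  apply: eq_esum => y _; rewrite esum_fset; last 2 first.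
  - exact: finite_seq.
  - by move=> x _; rewrite lee_fin.
  by rewrite -fsbig_seq// sumEFin.
rewrite esum_esum; last by move=> *; rewrite lee_fin.
have swap : set_bij ([set: X] `*`` (fun x => [set y | x \in row y]))
    ([set: Y] `*`` (fun y => [set` row y])) (fun p => (p.2, p.1)).
  split=> [[x y] [_ /= xy]|[x y] [x' y'] _ _ [-> ->] //|[y x] [_ /= xy]].
    by split.
  by exists (x, y).
rewrite (reindex_esum _ _ _ _ swap) /=.
rewrite -(esum_esum (I := setT) (J := fun x => [set y | x \in row y])
  (a := fun x y => (a x)%:E)); last by move=> *; rewrite lee_fin.
apply: (@le_trans _ _ (\esum_(x in [set: X]) (M%:R * a x)%:E)%E).
  apply: le_esum => x _; have [s sM sP] := colM x.
  have fin : finite_set [set y | x \in row y].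
    by apply: sub_finite_set (finite_seq s) => y /sP.
  have /finite_seqP[t tE] := fin.
  have uE : [set y | x \in row y] = [set` undup t].
    by rewrite tE; apply/seteqP; split => y /=; rewrite mem_undup.
  rewrite esum_fset//; last by move=> y _; rewrite lee_fin.
  rewrite uE -fsbig_seq ?undup_uniq// sumEFin lee_fin.
  rewrite big_const_seq count_predT iter_addr addr0 -[leLHS]mulr_natl.
  apply: ler_wpM2r => //; rewrite ler_nat.
  apply: leq_trans sM; apply: uniq_leq_size.
    exact: undup_uniq.
  by move=> y yt; apply: sP; have : [set` undup t] y by []; rewrite -uE.
apply: ge_ereal_sup => _ [Z [finZ _] <-].
under eq_fsbigr => x _ do rewrite EFinM.
rewrite -ge0_mule_fsumr; last by move=> x; rewrite lee_fin.
apply: lee_wpmul2l; first by rewrite lee_fin.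
by apply: esum_ge; exists Z.
Qed.

(** Comparing the square of a sum with the sum of the squares costs [2 ^ N] in
    each row, and summing over the rows costs [M]. *)
Lemma matrix_fun_bound (f : ell2 R X) :
  (sqsum (matrix_fun f) <= (2%:R ^+ N * M%:R)%:E * sqsum f)%E.
Proof.
apply: (@le_trans _ _ (\esum_(y in [set: Y])
    (\sum_(x <- row y) 2%:R ^+ N * normc (f x) ^+ 2)%:E)%E).
  apply: le_esum => y _; rewrite lee_fin -mulr_sumr.
  apply: le_trans (normc_sum_sq _ _) _.
  apply: ler_pM; rewrite ?exprn_ge0//.
    by apply: sumr_ge0 => *; exact: sqr_ge0.
    by rewrite ler_weXn2l// ler1n.
  apply: ler_sum => x _.
  by rewrite Normc.normcM K1 mul1r.
have a0 x : 0 <= 2%:R ^+ N * normc (f x) ^+ 2.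
  by apply: mulr_ge0; [exact: exprn_ge0|exact: sqr_ge0].
apply: le_trans (esum_rows a0) _.
rewrite mulrC EFinM -muleA; apply: lee_wpmul2l; first by rewrite lee_fin.
apply: ge_ereal_sup => _ [Z [finZ _] <-].
under eq_fsbigr => x _ do rewrite EFinM.
rewrite -ge0_mule_fsumr; last by move=> x; rewrite lee_fin sqr_ge0.
apply: lee_wpmul2l; first by rewrite lee_fin exprn_ge0.
by apply: esum_ge; exists Z.
Qed.

Lemma matrix_fun_sqsummable (f : ell2 R X) :
  matrix_fun f \in @sqsummable R Y.
Proof.
rewrite /sqsummable unfold_in; apply: le_lt_trans (matrix_fun_bound f) _.
by rewrite -ell2_norm_sq -EFinM ltry.
Qed.

Definition matrix_op (f : ell2 R X) : ell2 R Y :=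
  MkEll2 (matrix_fun_sqsummable f).

Lemma matrix_op_linear : linear matrix_op.
Proof.
move=> a f g; apply: ell2_eq => y.
change (matrix_fun (a *: f + g : ell2 R X) y =
  a * (matrix_fun f y : R[i]) + (matrix_fun g y : R[i])).
rewrite /matrix_fun mulr_sumr -big_split; apply: eq_bigr => x _.
change (K x y * (a * (f x : R[i]) + (g x : R[i])) =
  a * (K x y * (f x : R[i])) + K x y * (g x : R[i])).
by rewrite mulrDr mulrCA.
Qed.

Lemma bounded_matrix_exists :
  exists A : {linear ell2 R X -> ell2 R Y}, bounded_op A /\
    forall f y, A f y = matrix_fun f y.
Proof.
pose A : {linear ell2 R X -> ell2 R Y} :=
  HB.pack matrix_op (GRing.isLinear.Build _ _ _ _ matrix_op matrix_op_linear).
exists A; split => //; exists (Num.sqrt (2%:R ^+ N * M%:R)) => f.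
rewrite -(@ler_pXn2r _ 2)// ?nnegrE ?mulr_ge0 ?ell2_norm_ge0 ?sqrtr_ge0//.
have e0 : 0 <= 2%:R ^+ N * M%:R :> R by rewrite mulr_ge0 ?exprn_ge0.
rewrite exprMn (sqr_sqrtr e0) -lee_fin [leRHS]EFinM (ell2_norm_sq f).
rewrite (ell2_norm_sq (A f)); exact: matrix_fun_bound.
Qed.

End bounded.

(** * Gaussian operators as intertwiners *)

Section character.
Variables (F : finFieldType) (R : realType) (chi : add_char F R).

Lemma add_char0 : chi 0 = 1.
Proof.
by apply: (mulfI (add_char_neq0 chi 0)); rewrite -add_charD addr0 mulr1.
Qed.

Variable mu : option nat.

Lemma weylE (v : V2 F mu) (f : ell2 R (Vd F mu)) x :
  weyl chi v f x =
  (f (x + v.1) : R[i]) * chi (dot x v.2 + 2%:R^-1 * dot v.1 v.2).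
Proof.
rewrite /weyl /= /weyl_fun; congr (_ * chi _).
have [s [us hx hv]] := vd_supp2 x v.1.
rewrite (fsum_suppE us) => [|j js]; last first.
  by rewrite hx// hv// mulr0 !mul0r addr0.
rewrite !(dotE (s := s))// mulr_sumr -big_split; apply: eq_bigr => j _.
by rewrite mulrA.
Qed.

Lemma weyl_delta (v : V2 F mu) y :
  weyl chi v (delta R (y + v.1)) =
  chi (dot y v.2 + 2%:R^-1 * dot v.1 v.2) *: delta R y.
Proof.
apply: ell2_eq => x; rewrite weylE.
change ((x + v.1 == y + v.1)%:R * chi (dot x v.2 + 2%:R^-1 * dot v.1 v.2) =
  chi (dot y v.2 + 2%:R^-1 * dot v.1 v.2) * (x == y)%:R :> R[i]).
rewrite (inj_eq (addIr _)); have [->|_] := eqVneq x y.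
  by rewrite mul1r mulr1.
by rewrite mul0r mulr0.
Qed.

End character.

Section gaussian_operator.
Variables (F : finFieldType) (R : realType) (chi : add_char F R).
Variables (mu nu : option nat).
Variables (H : set (Vd F mu * Vd F nu)) (Q : Vd F mu * Vd F nu -> F).
Hypotheses (GD : gaussian_data H Q) (two : 2%:R != 0 :> F).

Let sH : subspace_set H. Proof. by case: GD. Qed.
Let qQ : quadratic_form_on H Q. Proof. by case: GD. Qed.

Let HD h k : H h -> H k -> H (h + k).
Proof. by move=> Hh Hk; rewrite -[h]scale1r; exact: sH.2. Qed.

Let HB h k : H h -> H k -> H (h - k).
Proof. by move=> Hh Hk; rewrite addrC -scaleN1r; exact: sH.2. Qed.

(** A nonempty fibre of [H] over x is a coset of the finite set of the y such
    that (y, 0) lies in [H]. *)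
Lemma gaussian_rows : exists (row : Vd F nu -> seq (Vd F mu)) (N : nat),
  forall x, [/\ uniq (row x), [set` row x] = [set y | H (y, x)] &
                (size (row x) <= N)%N].
Proof.
have [/finite_seqP[K KE] _] := gaussian_data_finite GD.
have rowP x : exists r : seq (Vd F mu),
    [/\ uniq r, [set` r] = [set y | H (y, x)] & (size r <= size K)%N].
  have [[y0 Hy0]|none] := pselect (exists y, H (y, x)); last first.
    exists [::]; split=> //; apply/seteqP; split => // y Hy.
    by exfalso; apply: none; exists y.
  exists (undup [seq y0 + z | z <- K]); split; first exact: undup_uniq.
    apply/seteqP; split => [y|y Hy] /=; rewrite mem_undup.
      move=> /mapP[z zK ->]; have Hz : H (z, 0).
        by have : [set` K] z by []; rewrite -KE.
      by rewrite -[x]addr0; exact: (HD Hy0 Hz).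
    apply/mapP; exists (y - y0); last by rewrite addrC subrK.
    have : [set y | H (y, 0)] (y - y0).
      by have := HB Hy Hy0; congr H; congr pair; rewrite subrr.
    by rewrite KE.
  by rewrite (leq_trans (size_undup _))// size_map.
have [row rowE] := choice rowP; by exists row, (size K).
Qed.

Lemma gaussian_cols : exists M : nat, forall y,
  exists2 s : seq (Vd F nu), (size s <= M)%N & forall x, H (y, x) -> x \in s.
Proof.
have [_ /finite_seqP[K KE]] := gaussian_data_finite GD.
exists (size K) => y.
have [[x0 Hx0]|none] := pselect (exists x, H (y, x)); last first.
  by exists [::] => // x Hx; exfalso; apply: none; exists x.
exists [seq x0 + z | z <- K]; first by rewrite size_map.
move=> x Hx; apply/mapP; exists (x - x0); last by rewrite addrC subrK.
have : [set x | H (0, x)] (x - x0).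
  by have := HB Hx Hx0; congr H; congr pair; rewrite subrr.
by rewrite KE.
Qed.

Lemma gaussian_bounded :
  exists A : {linear ell2 R (Vd F mu) -> ell2 R (Vd F nu)},
    bounded_op A /\ forall (f : ell2 R (Vd F mu)) x,
      A f x = gaussian chi H Q f x.
Proof.
have [row [N rowP]] := gaussian_rows; have [M colP] := gaussian_cols.
have rowU x : uniq (row x) by case: (rowP x).
have rowN x : (size (row x) <= N)%N by case: (rowP x).
have rowE x : [set` row x] = [set y | H (y, x)] by case: (rowP x).
have [|A [bA AE]] := @bounded_matrix_exists R _ _ row
    (fun y x => chi (Q (y, x))) N M rowU rowN _
    (fun y x => normc_add_char chi (Q (y, x))).
  move=> y; have [s sM sP] := colP y; exists s => // x yx; apply: sP.
  by have : [set` row x] y by []; rewrite rowE.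
exists A; split => // f x; rewrite AE /gaussian /matrix_fun -rowE.
exact: fsbig_seq.
Qed.

(** Twice [Q] is its polar form on the diagonal. *)
Lemma lagr_quadratic_value p : lagr H Q p ->
  Q (base p) = 2%:R^-1 * dot p.1.1 p.1.2 - 2%:R^-1 * dot p.2.1 p.2.2.
Proof.
move=> [Hp pE]; have := pE _ Hp.
have -> : base p + base p = 2%:R *: base p by rewrite scaler_nat.
rewrite qQ.1// /cpair /= => e; rewrite -mulrBr -e; field.
exact: two.
Qed.

(** Shifting the summation variable by v^d turns the sum over the fibre at x
    into the sum over the fibre at x + w^d; the phases agree by the equation
    that defines [lagr H Q]. *)
Lemma gaussian_intertwines (A : {linear ell2 R (Vd F mu) -> ell2 R (Vd F nu)}) :
  (forall (f : ell2 R (Vd F mu)) x, A f x = gaussian chi H Q f x) ->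
  forall v w, lagr H Q (v, w) -> forall f, weyl chi w (A f) = A (weyl chi v f).
Proof.
move=> AE v w Tvw f; apply: ell2_eq => x; rewrite weylE !AE /gaussian.
have [Hk kE] := Tvw; have Qk := lagr_quadratic_value Tvw.
have bij : set_bij [set y | H (y, x)] [set y | H (y, x + w.1)]
    (fun y => y + v.1).
  split=> [y /= Hy|y y' _ _ /addIr //|y /= Hy]; first exact: (HD Hy Hk).
  exists (y - v.1); last by rewrite subrK.
  by have := HB Hy Hk; congr H; congr pair; rewrite addrK.
rewrite mulr_fsuml (reindex_fsbig _ _ _ _ bij).
apply: eq_fsbigr => y /set_mem Hy.
rewrite weylE [in LHS]mulrAC [RHS]mulrA [in RHS]mulrAC -!add_charD.
congr (chi _ * _).
have := kE _ Hy; rewrite Qk.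
have -> : (y, x) + base (v, w) = (y + v.1, x + w.1) by [].
by rewrite /cpair /= => /eqP; rewrite !subr_eq => /eqP ->; ring.
Qed.

Lemma gaussian_delta0 : gaussian chi H Q (delta R 0) 0 = 1.
Proof.
have Q0 : Q 0 = 0.
  by have := qQ.1 0 0 sH.1; rewrite scale0r expr0n mul0r.
rewrite /gaussian (fsbigE [:: 0])//=.
- rewrite big_mkcond big_seq1 ifT; last by rewrite inE; exact: sH.1.
  have -> : (0, 0) = 0 :> Vd F mu * Vd F nu by [].
  by rewrite Q0 add_char0 eqxx mulr1.
- by move=> y /=; rewrite inE => /eqP ->; exact: sH.1.
- by move=> y _; rewrite inE => /negPf /= ->; rewrite mulr0.
Qed.

Lemma gaussian_is_W : exists A : {linear ell2 R (Vd F mu) -> ell2 R (Vd F nu)},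
  is_W chi (lagr H Q) A /\
  forall (f : ell2 R (Vd F mu)) x, gaussian chi H Q f x = A f x.
Proof.
have [A [bA AE]] := gaussian_bounded; exists A; split => //; split => //.
  exists (delta R 0); apply/eqP => A0.
  have := AE (delta R 0) 0; rewrite A0 gaussian_delta0 => /esym/eqP.
  by rewrite oner_eq0.
exact: gaussian_intertwines.
Qed.

(** The intertwining relations express the matrix entry at (y + v^d, x + w^d)
    through the one at (y, x). For an entry outside of [H], some element over 0
    says that it equals itself times a character value different from 1, so it
    vanishes; from the entry at 0 one reaches the one at any k in [H], with the
    factor chi (Q k). *)
Lemma is_W_gaussian (A : {linear ell2 R (Vd F mu) -> ell2 R (Vd F nu)}) :
  nontrivial_char chi -> is_W chi (lagr H Q) A ->
  exists2 c : R[i], c != 0 &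
    forall (f : ell2 R (Vd F mu)) x, A f x = c * gaussian chi H Q f x.
Proof.
move=> [t chit] [bA [g Ag] WA].
pose K (y : Vd F mu) (x : Vd F nu) : R[i] := A (delta R y) x.
have KE v w : lagr H Q (v, w) -> forall y x,
    K (y + v.1) (x + w.1) * chi (dot x w.2 + 2%:R^-1 * dot w.1 w.2) =
    chi (dot y v.2 + 2%:R^-1 * dot v.1 v.2) * K y x.
  move=> Tvw y x; rewrite /K -weylE (WA _ _ Tvw) weyl_delta linearZ.
  by [].
have K0 y x : ~ H (y, x) -> K y x = 0.
  move=> nH; have [psi [lin psi0 psi1]] := separating_functional sH nH.
  have [c [d cdE]] := cpair_functional lin.
  have Tcd : lagr H Q ((0, t *: c), (0, t *: d)).
    split; first exact: sH.1.
    move=> h Hh.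
    have -> : base ((0, t *: c), (0, t *: d)) = 0 :> Vd F mu * Vd F nu by [].
    by rewrite (polar0 qQ)// /cpair /= !dotZr -mulrBr -cdE psi0// mulr0.
  have := KE _ _ Tcd y x; rewrite /= !addr0 !dot0l !mulr0 !addr0 !dotZr.
  have := cdE (y, x); rewrite psi1 /= => /esym/eqP; rewrite subr_eq => /eqP ->.
  rewrite mulrDr mulr1 add_charD [RHS]mulrC mulrA.
  move=> /(mulIf (add_char_neq0 _ _)).
  move=> /eqP; rewrite -[X in X == _]mulr1 -subr_eq0 -mulrBr mulf_eq0.
  by rewrite subr_eq0 [1 == _]eq_sym (negPf chit) orbF => /eqP.
have KH y x : H (y, x) -> K y x = K 0 0 * chi (Q (y, x)).
  move=> Hyx; have [p Tp pE] := lagr_over sH qQ Hyx.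
  have := KE _ _ (Tp : lagr H Q (p.1, p.2)) 0 0.
  rewrite !add0r !dot0l !add0r => e.
  have [<- <-] : p.1.1 = y /\ p.2.1 = x by case: pE.
  rewrite -[(p.1.1, p.2.1)]/(base p) (lagr_quadratic_value Tp).
  apply: (mulIf (add_char_neq0 chi (2%:R^-1 * dot p.2.1 p.2.2))).
  by rewrite e -mulrA -add_charD subrK mulrC.
have [row [N rowP]] := gaussian_rows.
have AE (f : ell2 R (Vd F mu)) x : A f x = K 0 0 * gaussian chi H Q f x.
  have [rowU rowE _] := rowP x.
  have inrow y : y \in row x -> H (y, x).
    by move=> yx; have : [set` row x] y by []; rewrite rowE.
  rewrite (bounded_matrix bA rowU) => [|y yx]; last first.
    apply: K0 => Hyx; move/negP: yx; apply.
    by have : [set y | H (y, x)] y by []; rewrite -rowE.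
  rewrite /gaussian -rowE -fsbig_seq// mulr_sumr big_seq [RHS]big_seq.
  apply: eq_bigr => y /inrow Hyx; rewrite -[A _ _]/(K y x) KH// mulrC mulrA.
  by [].
exists (K 0 0) => //; apply: contraNneq Ag => K00.
by apply/eqP/ell2_eq => x; rewrite AE K00 mul0r.
Qed.

End gaussian_operator.

Theorem theorem1p6 (R : realType) (F : finFieldType) (p : nat)
    (hp : p \in [pchar F]) (hp2 : (2 < p)%N)
    (Exp : add_char F R) (hExp : nontrivial_char Exp)
    (mu nu : option nat) :
  (forall T : set (V2 F mu * V2 F nu), perfect_lagrangian T ->
     (exists A : {linear ell2 R (Vd F mu) -> ell2 R (Vd F nu)}, is_W Exp T A) /\
     (forall A : {linear ell2 R (Vd F mu) -> ell2 R (Vd F nu)}, is_W Exp T A ->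
        exists (H : set (Vd F mu * Vd F nu)) (Q : Vd F mu * Vd F nu -> F)
               (c : R[i]),
          [/\ gaussian_data H Q, c != 0 &
              forall (f : ell2 R (Vd F mu)) (x : Vd F nu),
                A f x = c * gaussian Exp H Q f x])) /\
  (forall (H : set (Vd F mu * Vd F nu)) (Q : Vd F mu * Vd F nu -> F),
     gaussian_data H Q ->
     exists (T : set (V2 F mu * V2 F nu))
            (A : {linear ell2 R (Vd F mu) -> ell2 R (Vd F nu)}) (c : R[i]),
       [/\ perfect_lagrangian T, is_W Exp T A, c != 0 &
           forall (f : ell2 R (Vd F mu)) (x : Vd F nu),
             gaussian Exp H Q f x = c * A f x]).
Proof.
have two : 2%:R != 0 :> F.
  by rewrite -(dvdn_pcharf hp) gtnNdvd.
split=> [T /(perfect_lagr two)[H [Q [GD ->]]]|H Q GD].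
  split; first by have [A [WA _]] := gaussian_is_W Exp GD two; exists A.
  move=> A WA; have [c c0 AE] := is_W_gaussian GD two hExp WA.
  by exists H, Q, c.
have [A [WA AE]] := gaussian_is_W Exp GD two.
exists (lagr H Q), A, 1; split => //; first exact: lagr_perfect.
by move=> f x; rewrite mul1r AE.
Qed.
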